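(* For every integer $n>0$ and every compact subspace $K\subset\mathbb R^n$ there exists a reproducing kernel Hilbert algebra (RKHA) $\mathcal H$ whose spectrum $\sigma(\mathcal H)$ is homeomorphic to $K$.
   Context: For a set $X$, $\mathcal L(X)$ is the space of complex-valued functions on $X$. A reproducing kernel Hilbert space (RKHS) on $X$ is a vector subspace $\mathcal H\subset\mathcal L(X)$ with an inner product (linear in the first argument) making it a Hilbert space on which every point evaluation is continuous; $k_x\in\mathcal H$ is the kernel section with $f(x)=\langle f,k_x\rangle$. An RKHS $\mathcal H$ is an RKHA if $k_x\mapsto k_x\otimes k_x$ ($x\in X$) extends to a bounded linear operator $\Delta\colon\mathcal H\to\mathcal H\otimes\mathcal H$ (Hilbert space tensor product); equivalently, pointwise multiplication extends to a bounded linear operator $\mathcal H\otimes\mathcal H\to\mathcal H$. An RKHA is a commutative Banach algebra under pointwise multiplication in a norm equivalent to the Hilbert space norm. Its spectrum $\sigma(\mathcal H)$ is the set of nonzero multiplicative linear functionals on $\mathcal H$ with the weak-$*$ topology. *)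

(* Defs.v *)
From HB Require Import structures.
From mathcomp Require Import all_boot all_order all_algebra.
From mathcomp Require Import complex.
From mathcomp Require Import all_classical all_reals all_analysis.

Set Implicit Arguments.
Unset Strict Implicit.
Unset Printing Implicit Defensive.

Import Order.TTheory GRing.Theory Num.Theory.
Import Num.Def.
Import numFieldNormedType.Exports.

Local Open Scope classical_set_scope.
Local Open Scope ring_scope.

(* The topology on scalars is attached to abstract number fields only, not to
   the type constructor [complex]; packing the complex numbers over R as a
   [numClosedFieldType] gives them the topology of the modulus. *)
Definition Cplx (R : realType) : numClosedFieldType := R[i]%C.

(* Completeness refers to the norm of the carrier; [inner_norm] identifies it
   with the norm of the inner product, which is linear in the first argument
   and conjugate-linear in the second. *)
Record hilbertSpace (R : realType) := HilbertSpace {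
  hilbert_sort :> completeNormedModType (Cplx R) ;
  inner : {dot hilbert_sort for conjC} ;
  inner_norm : forall u : hilbert_sort, `|u| ^+ 2 = inner u u }.

Definition bounded_operator (R : realType) (U V : hilbertSpace R)
    (A : {linear U -> V}) : Prop :=
  exists M : Cplx R, forall u : U, `|A u| <= M * `|u|.

(* A Hilbert space tensor product of U and V: it is determined up to a unique
   unitary map compatible with [tens]. Scalars need not appear in the linear
   combinations of simple tensors since [tens] is bilinear. *)
Record hilbertTensor (R : realType) (U V : hilbertSpace R) := HilbertTensor {
  tensor_space :> hilbertSpace R ;
  tens : {bilinear U -> V -> tensor_space} ;
  tens_inner : forall (u u' : U) (v v' : V),
    inner tensor_space (tens u v) (tens u' v') =
    inner U u u' * inner V v v' ;
  tens_dense :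
    dense [set t : tensor_space |
           exists s : seq (U * V), t = \sum_(p <- s) tens p.1 p.2] }.

(* A vector subspace of the functions X -> C is given by an abstract space with
   an injective linear map [evalf] to functions: [evalf f x] is f(x). *)
Record rkhs (R : realType) (X : Type) := RKHS {
  rkhs_space :> hilbertSpace R ;
  evalf : {linear rkhs_space -> (X -> Cplx R)} ;
  evalf_inj : injective evalf ;
  evalf_continuous :
    forall x : X, continuous (fun f : rkhs_space => evalf f x : Cplx R) }.

(* The representer of evaluation at x: it exists and is unique by the Riesz
   representation theorem, so the default value of [get] is never used. *)
Definition kernel_section (R : realType) (X : Type) (H : rkhs R X) (x : X) : H :=
  get [set k : H | forall f : H, evalf H f x = inner H f k].

Definition is_rkha (R : realType) (X : Type) (H : rkhs R X) : Prop :=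
  exists (T : hilbertTensor H H) (Delta : {linear H -> T}),
    bounded_operator Delta /\
    forall x : X, Delta (kernel_section H x) =
                  tens T (kernel_section H x) (kernel_section H x).

(* An RKHA is closed under pointwise products, so the last condition is
   chi (f g) = chi f * chi g for all f and g in H. The ambient type carries the
   topology of pointwise convergence on H, which induces the weak-* topology. *)
Definition spectrum (R : realType) (X : Type) (H : rkhs R X) :
    set {ptws H -> Cplx R} :=
  [set chi | [/\ scalar chi,
                 exists f : H, chi f != 0 &
                 forall f g h : H,
                   (forall x : X, evalf H h x = evalf H f x * evalf H g x) ->
                   chi h = chi f * chi g]].

Definition homeomorphic (S T : topologicalType) : Prop :=
  exists (f : S -> T) (g : T -> S),
    [/\ continuous f, continuous g, cancel f g & cancel g f].

Arguments spectrum {R X} H.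

(* Main.v *)
Require Import Defs.
From HB Require Import structures.
From mathcomp Require Import all_boot all_order all_algebra.
From mathcomp Require Import finmap complex.
From mathcomp Require Import all_classical all_reals all_analysis.
From mathcomp Require Import ring lra.
Import Order.TTheory GRing.Theory Num.Theory.
Import Num.Def.
Import numFieldNormedType.Exports.
Local Open Scope classical_set_scope.
Local Open Scope ring_scope.
Set Implicit Arguments.
Unset Strict Implicit.
Unset Printing Implicit Defensive.

(** If kappa is a positive definite kernel with kappa(x, x) <= 1, then
    k = sum_m kappa^m / (m + 2)^2 satisfies k^2 <= 4 k as kernels, and such an
    inequality says exactly that k_x |-> k_x (x) k_x is bounded.  For
    kappa(x, y) = sum_j g_j(x) g_j(y)^*, the space of k is the closed span of
    the vectors Phi_x in l^2 of the words over the index set of the g_j, the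
    coordinate of Phi_x at a word being the weighted conjugate product of the
    letters evaluated at x; in these coordinates the comultiplication is
    deconcatenation.

    Take as g_j weighted powers b^(m+1) of countably many functions b on K with
    |b| <= 1.  A character chi is bounded, and the weights of the powers decay
    only like 1/m, so |chi(b)|^m grows at most linearly and |chi(b)| <= 1.
    Apply this to the rescaled coordinates and to the functions
    p_r(x) = 1 - eps_r (|x - r|^2 - d_r), where r is a rational point and
    d_r = min_K |x - r|^2.  With beta = chi(coordinates),
    Re chi(p_r) <= 1 reads d_r + |Im beta|^2 <= |Re beta - r|^2; letting r tend
    to Re beta, beta is real and lies in K, and chi is evaluation at beta. *)

(** The weights cannot be geometric: for w_m = q^m every cut of a word of length n contributes 1,
    and deconcatenation is unbounded. For w_m = 1/(m+2) the cut at k contributes at most w_k +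
    w_(n-k), which is square-summable uniformly in n. The powers of b have to be letters themselves.
    Since sum_j |g_j|^2 <= 1 is required, each b is scaled down by some c < 1; with c b as the only
    letter, the word for b^m would have a norm bound of order c^(-m), and only |chi(b)| <= 1/c would
    follow. As a single letter, b^m costs a factor linear in m. The same requirement explains why
    the family is countable and r rational. The value chi(p_r) is already determined by chi on the
    coordinates. What p_r gains by being a letter is the bound |chi(p_r)| <= 1, which excludes
    characters away from K. Words replace commutative monomials because a pair of words is just a
    word with a cut, so no multinomial coefficients appear; commutativity returns on the closed span
    of the Phi_x. *)

Section FiniteSums.
Variable K : numDomainType.

Lemma ler_sum_fsubset (I : choiceType) (F : I -> K) (A B : {fset I}) :
  (forall i, 0 <= F i) -> (A `<=` B)%fset ->
  \sum_(i <- A) F i <= \sum_(i <- B) F i.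
Proof.
move=> F0 AB; rewrite (big_fsetID _ (mem A) B) /=.
rewrite (_ : [fset x in B | x \in A]%fset = A); last first.
  by apply/fsetP => x; rewrite !inE /= andb_idl//; apply/fsubsetP.
by rewrite lerDl sumr_ge0.
Qed.

(** The substitute for Fubini: infinite sums are bounded through their finite partial sums, and a
    finite set of pairs is cut into its fibres over the first coordinate, on each of which the
    second coordinate is injective. *)
Lemma ler_sum_fst (I J : choiceType) (B : {fset I * J}) (F : I -> J -> K)
    (c : I -> K) :
  (forall i j, 0 <= F i j) ->
  (forall i (J0 : {fset J}), \sum_(j <- J0) F i j <= c i) ->
  \sum_(p <- B) F p.1 p.2 <= \sum_(i <- [fset p.1 | p in B]%fset) c i.
Proof.
move=> F0 Fc; rewrite (partition_big_imfset _ (fun p : I * J => p.1)) /=.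
apply: ler_sum => i _.
apply: le_trans (Fc i [fset p.2 | p in [fset p in B | p.1 == i]]%fset).
rewrite [leRHS]big_imfset /=; last first.
  by move=> [i1 j1] [i2 j2]; rewrite !inE /= => /andP[_ /eqP->] /andP[_ /eqP->] ->.
rewrite big_fset /=; apply: ler_sum => -[i1 j1] /= /eqP -> //.
Qed.

End FiniteSums.

Lemma cvg_ext (T : Type) (U : topologicalType) (F : set_system T)
    (f g : T -> U) (l : U) :
  f =1 g -> f x @[x --> F] --> l -> g x @[x --> F] --> l.
Proof. by move=> /funext ->. Qed.

(** * Limits and completeness of the complex numbers *)

Section ClosedFieldLimits.
Variable C : numClosedFieldType.

Lemma cvg_limit_unique (T : Type) (F : set_system T)
    (f : T -> C) (l m : C) {FF : ProperFilter F} :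
  f x @[x --> F] --> l -> f x @[x --> F] --> m -> l = m.
Proof. exact: cvg_unique. Qed.

(** The order on the scalars is partial; the limit is nonnegative because [f] eventually agrees with
    its norm and so converges to [|l|] as well. *)
Lemma cvg_ge0 (T : Type) (F : set_system T)
    (f : T -> C) (l : C) {FF : ProperFilter F} :
  f x @[x --> F] --> l -> (\forall x \near F, 0 <= f x) ->
  0 <= l.
Proof.
move=> fl f0.
have nl : `|f x| @[x --> F] --> `|l| by exact: cvg_norm.
have : f x @[x --> F] --> `|l|.
  by apply: cvg_trans nl; apply: near_eq_cvg; near=> x; rewrite ger0_norm//; near: x.
move=> /(cvg_unique _ fl) -> //.
Unshelve. all: by end_near. Qed.

Lemma cvg_le_le (T : Type) (F : set_system T)
    (f g : T -> C) (l m : C) {FF : ProperFilter F} :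
  f x @[x --> F] --> l -> g x @[x --> F] --> m ->
  (\forall x \near F, f x <= g x) -> l <= m.
Proof.
move=> fl gm fg; rewrite -subr_ge0.
apply: (@cvg_ge0 _ F (fun x => g x - f x)); first exact: cvgB.
by near=> x; rewrite subr_ge0; near: x.
Unshelve. all: by end_near. Qed.

Lemma cvg_conj (T : Type) (F : set_system T)
    (f : T -> C) (l : C) {FF : Filter F} :
  f x @[x --> F] --> l -> (f x)^* @[x --> F] --> l^*.
Proof.
move=> /cvgrPdist_lt fl; apply/cvgrPdist_lt => e e0.
by near=> x; rewrite -rmorphB norm_conjC; near: x; exact: fl.
Unshelve. all: by end_near. Qed.

Lemma cvg_sum_seq (T : Type) (F : set_system T) (I : Type) (r : seq I)
    (f : T -> I -> C) (a : I -> C) {FF : Filter F} :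
  (forall i, f x i @[x --> F] --> a i) ->
  \sum_(i <- r) f x i @[x --> F] --> \sum_(i <- r) a i.
Proof. by move=> fa; apply: cvg_big => //; exact: add_continuous. Qed.

Lemma cvg_norm2 (T : Type) (F : set_system T)
    (f : T -> C) (a : C) {FF : Filter F} :
  f x @[x --> F] --> a -> `|f x| ^+ 2 @[x --> F] --> `|a| ^+ 2.
Proof. by move=> /cvg_norm fa; apply: cvgM. Qed.

End ClosedFieldLimits.

Section ComplexLimits.
Variable R : realType.
Local Notation C := (Cplx R).

Definition ofR (x : R) : C := x%:C%C.

Lemma ofR_le x y : (ofR x <= ofR y) = (x <= y).
Proof. exact: lecR. Qed.

Lemma ofR_lt x y : (ofR x < ofR y) = (x < y).
Proof. exact: ltcR. Qed.

Lemma ofRD : {morph ofR : x y / x + y}.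
Proof. exact: rmorphD. Qed.

Lemma ofRB : {morph ofR : x y / x - y}.
Proof. exact: rmorphB. Qed.

Lemma ofR0 : ofR 0 = 0.
Proof. exact: rmorph0. Qed.

Lemma ofRM : {morph ofR : x y / x * y}.
Proof. exact: rmorphM. Qed.

Definition reC (z : C) : R := complex.Re z.

Lemma ofR_reC (z : C) : z \is Num.real -> ofR (reC z) = z.
Proof. exact: RRe_real. Qed.

Lemma reC_ofR (x : R) : reC (ofR x) = x.
Proof. by []. Qed.

Lemma ofR_norm (x : R) : `|ofR x| = ofR `|x|.
Proof. by rewrite /ofR normc_def /= expr0n addr0 sqrtr_sqr. Qed.

(* Unification would otherwise unfold [Cplx] and diverge while looking for the
   topological structures of the scalars. *)
Local Opaque Cplx.

Lemma reC_ge0 (z : C) : 0 <= z -> 0 <= reC z.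
Proof. by move=> z0; rewrite -ofR_le ofR0 ofR_reC// realE z0. Qed.

Lemma gt0_ofR (e : C) : 0 < e -> e = ofR (reC e) /\ 0 < reC e.
Proof.
move=> e0; have er : e = ofR (reC e) by rewrite ofR_reC// realE ltW.
by split => //; rewrite -ofR_lt -er.
Qed.

Lemma cvg_ofR (T : Type) (F : set_system T)
    (f : T -> R) (l : R) {FF : Filter F} :
  f x @[x --> F] --> l -> ofR (f x) @[x --> F] --> ofR l.
Proof.
move=> /cvgrPdist_lt fl; apply/cvgrPdist_lt => e /gt0_ofR[-> e0].
by near=> x; rewrite -ofRB ofR_norm ofR_lt; near: x; exact: fl.
Unshelve. all: by end_near. Qed.

Lemma norm_reC (z : C) : ofR `|reC z| <= `|z|.
Proof. exact: normc_ge_Re. Qed.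

Lemma reCB : {morph reC : x y / x - y}.
Proof. exact: raddfB. Qed.

Lemma reCD : {morph reC : x y / x + y}.
Proof. exact: raddfD. Qed.

Lemma cvg_reC (T : Type) (F : set_system T)
    (f : T -> C) (l : C) {FF : Filter F} :
  f x @[x --> F] --> l -> reC (f x) @[x --> F] --> reC l.
Proof.
move=> /cvgrPdist_lt fl; apply/cvgrPdist_lt => e e0.
near=> x; rewrite -reCB -ofR_lt; apply: le_lt_trans (norm_reC _) _.
by near: x; apply: fl; rewrite (_ : 0 = ofR 0)// ofR_lt.
Unshelve. all: by end_near. Qed.

Lemma reC_decomp (z : C) : z = ofR (reC z) + 'i * ofR (reC (- 'i * z)).
Proof.
have -> : ofR (reC z) = 'Re z by exact: complexRe.
have -> : ofR (reC (- 'i * z)) = 'Re (- 'i * z) by exact: complexRe.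
by rewrite mulNr raddfN /= ReMil opprK -Crect.
Qed.

Lemma Cplx_complete (F : set_system C) : ProperFilter F -> cauchy F ->
  exists l : C, F --> l.
Proof.
move=> FF Fc.
(* A 1-Lipschitz map keeps the filter Cauchy, so completeness of the reals applies to the real part
   of [h]; [h] will be the identity and multiplication by [- 'i]. *)
have main (h : C -> C) : (forall x y, `|h x - h y| <= `|x - y|) ->
    exists l : R, (reC (h x)) @[x --> F] --> l.
  move=> hl; apply/cvg_ex; apply: R_complete; apply/cauchy_ballP => e e0.
  have e0' : 0 < ofR e by rewrite (_ : 0 = ofR 0)// ofR_lt.
  have /cauchy_ballP/(_ _ e0')[[A B] /= [FA FB] AB] := Fc.
  exists ((reC \o h) @` A, (reC \o h) @` B).
    by split => /=; [apply: filterS FA|apply: filterS FB] => x ? /=; exists x.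
  move=> [_ _] /= [[a Aa <-] [b Bb <-]].
  have /= := AB (a, b); rewrite /ball /= /ball_ => /(_ (conj Aa Bb)) ab.
  rewrite -ofR_lt -reCB; apply: le_lt_trans (norm_reC _) _.
  exact: le_lt_trans (hl _ _) ab.
have [l1 h1] : exists l : R, (reC x) @[x --> F] --> l by exact: (main id).
have [l2 h2] : exists l : R, (reC (- 'i * x)) @[x --> F] --> l.
  by apply: main => x y; rewrite -mulrBr normrM normrN normCi mul1r.
exists (ofR l1 + 'i * ofR l2).
have : ofR (reC x) + 'i * ofR (reC (- 'i * x)) @[x --> F] -->
    ofR l1 + 'i * ofR l2.
  apply: cvgD; first exact: cvg_ofR.
  by apply: cvgM; [exact: cvg_cst|exact: cvg_ofR].
by under eq_fun do rewrite -reC_decomp.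
Qed.

End ComplexLimits.

(** * Square-summable families *)

Section FinsetFilter.
Variable I : choiceType.

(** Limits along this filter are unconditional sums; the index set needs neither an order nor an
    enumeration. *)
Definition finsets : set_system {fset I} :=
  filter_from setT (fun A => [set B | (A `<=` B)%fset]).

#[global] Instance finsets_filter : ProperFilter finsets.
Proof.
apply: filter_from_proper; last by move=> A _; exists A => /=.
apply: filter_fromT_filter; first by exists fset0.
by move=> A B /=; exists (A `|` B)%fset => P /=; rewrite fsubUset => /andP[].
Qed.

Lemma near_finsets (A : {fset I}) : \forall B \near finsets, (A `<=` B)%fset.
Proof. by exists A. Qed.

End FinsetFilter.
Arguments finsets {I}.
#[global] Hint Extern 0 (ProperFilter finsets) => exact: finsets_filter : core.
#[global] Hint Extern 0 (Filter finsets) => exact: finsets_filter : core.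

Section SquareSummable.
Variables (R : realType) (I : choiceType).
Local Notation C := (Cplx R).
Implicit Types (a b c : I -> C) (z : I -> C) (B : {fset I}).

Definition asum z : C := lim (\sum_(i <- (B : {fset I})) z i @[B --> finsets]).

Lemma cvg_sum_ge0 z (M : C) : (forall i, 0 <= z i) ->
  (forall B, \sum_(i <- B) z i <= M) ->
  exists l : C, \sum_(i <- (B : {fset I})) z i @[B --> finsets] --> l.
Proof.
move=> z0 zM; pose f B := reC (\sum_(i <- B) z i).
have fE B : ofR (f B) = \sum_(i <- B) z i by rewrite ofR_reC// realE sumr_ge0.
have M0 : 0 <= M by apply: le_trans (zM fset0); rewrite big_seq_fset0.
have fs : has_sup (range f).
  split; first by exists (f fset0), fset0.
  by exists (reC M) => _ [B _ <-]; rewrite -ofR_le fE ofR_reC// realE M0.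
exists (ofR (sup (range f))); apply/cvgrPdist_lt => e /gt0_ofR[-> e0].
have [_ [B0 _ <-] fB0] := sup_adherent e0 fs.
near=> B; rewrite /= -fE -ofRB ofR_norm ofR_lt ltr_norml.
have fB : f B <= sup (range f) by apply: sup_upper_bound => //; exists B.
have : f B0 <= f B.
  by rewrite -ofR_le !fE ler_sum_fsubset//; near: B; exact: near_finsets.
move: fB fB0 e0; lra.
Unshelve. all: by end_near. Qed.

Lemma cvg_asum z (M : C) : (forall B, \sum_(i <- B) `|z i| <= M) ->
  \sum_(i <- (B : {fset I})) z i @[B --> finsets] --> asum z.
Proof.
move=> zM.
suff : exists l : C, \sum_(i <- (B : {fset I})) z i @[B --> finsets] --> l by move/cvg_ex.
(* [h] is the real or the imaginary part: [h (z i)] is the difference of [h (z i) + |z i|] and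
   [|z i|], two nonnegative families with bounded partial sums. *)
have rM (h : C -> C) : (forall w, h w \is Num.real) -> (forall w, `|h w| <= `|w|) ->
    exists l : C, \sum_(i <- (B : {fset I})) h (z i) @[B --> finsets] --> l.
  move=> hr hz.
  have [||l1 h1] := @cvg_sum_ge0 (fun i => h (z i) + `|z i|) (M + M).
  - by move=> i; rewrite -lerBlDr sub0r; have := hz (z i); rewrite real_ler_norml// => /andP[].
  - move=> B; rewrite big_split /= lerD//.
    apply: le_trans (zM B); apply: ler_sum => i _; apply: le_trans (hz _).
    by rewrite real_ler_norm.
  have [||l2 h2] := @cvg_sum_ge0 (fun i => `|z i|) M => //.
  exists (l1 - l2); apply: cvg_ext (cvgB h1 h2) => B /=.
  by rewrite -[LHS]/(_ - _) big_split /= addrK.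
have [||l1 h1] := rM (fun w => 'Re w).
- by move=> w; rewrite Creal_Re.
- by move=> w; rewrite leif_normC_Re_Creal.
have [||l2 h2] := rM (fun w => 'Im w).
- by move=> w; rewrite Creal_Im.
- by move=> w; rewrite -normrN -ReMil -[leRHS]mul1r -(normCi C) -normrM leif_normC_Re_Creal.
exists (l1 + 'i * l2); apply: cvg_ext (cvgD h1 (cvgM (cvg_cst 'i) h2)) => B.
rewrite -[LHS]/(_ + _ * _) mulr_sumr -big_split /=.
by under eq_bigr do rewrite -Crect.
Unshelve. all: by end_near. Qed.

Lemma asum_ge_partial z (M : C) B : (forall i, 0 <= z i) ->
  (forall B, \sum_(i <- B) z i <= M) -> \sum_(i <- B) z i <= asum z.
Proof.
move=> z0 zM; have zc : \sum_(i <- (B : {fset I})) z i @[B --> finsets] --> asum z.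
  by apply: (@cvg_asum _ M) => B'; under eq_bigr do rewrite ger0_norm//.
apply: (cvg_le_le (cvg_cst _) zc).
by near=> B'; apply: ler_sum_fsubset => //; near: B'; exact: near_finsets.
Unshelve. all: by end_near. Qed.

Lemma asum_le z (M : C) : (forall i, 0 <= z i) ->
  (forall B, \sum_(i <- B) z i <= M) -> asum z <= M.
Proof.
move=> z0 zM; have zc : \sum_(i <- (B : {fset I})) z i @[B --> finsets] --> asum z.
  by apply: (@cvg_asum _ M) => B'; under eq_bigr do rewrite ger0_norm//.
by apply: (@cvg_le_le _ _ _ _ (fun=> M) _ M _ zc (cvg_cst _)); apply: nearW.
Qed.

(** Bounds the squared norm while mentioning finite sums only, so that no summability has to be
    known beforehand. *)
Definition l2le a (M : C) := forall B, \sum_(i <- B) `|a i| ^+ 2 <= M.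

Definition l2 : set (I -> C) := [set a | exists M, l2le a M].

Definition dot a b : C := asum (fun i => a i * (b i)^*).

Lemma l2le_ge0 a M : l2le a M -> 0 <= M.
Proof. by move=> /(_ fset0); rewrite big_seq_fset0. Qed.

Lemma sqr_normD_le (x y : C) : `|x + y| ^+ 2 <= 2 * (`|x| ^+ 2 + `|y| ^+ 2).
Proof.
have xy : `|x + y| ^+ 2 <= (`|x| + `|y|) ^+ 2.
  by rewrite lerXn2r// ?nnegrE ?addr_ge0// ler_normD.
apply: le_trans xy _; rewrite -subr_ge0.
rewrite (_ : _ - _ = (`|x| - `|y|) ^+ 2); last by ring.
by rewrite real_exprn_even_ge0// rpredB// normr_real.
Qed.

Lemma l2leD a b M N : l2le a M -> l2le b N -> l2le (a + b) (2 * (M + N)).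
Proof.
move=> aM bN B; apply: (@le_trans _ _ (\sum_(i <- B) 2 * (`|a i| ^+ 2 + `|b i| ^+ 2))).
  by apply: ler_sum => i _; exact: sqr_normD_le.
by rewrite -mulr_sumr big_split /= ler_wpM2l// lerD.
Qed.

Lemma l2leZ k a M : l2le a M -> l2le (k *: a) (`|k| ^+ 2 * M).
Proof.
move=> aM B; under eq_bigr do rewrite normrM exprMn.
by rewrite -mulr_sumr ler_wpM2l// exprn_ge0.
Qed.

Lemma l2_0 : l2 0.
Proof. by exists 0 => B; rewrite big1// => i _; rewrite normr0 expr0n. Qed.

Lemma l2_lin k a b : l2 a -> l2 b -> l2 (k *: a + b).
Proof.
by move=> [M aM] [N bN]; eexists; apply: l2leD bN; apply: l2leZ; exact: aM.
Qed.

Lemma l2B a b : l2 a -> l2 b -> l2 (a - b).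
Proof. by move=> la lb; rewrite addrC -scaleN1r; exact: l2_lin. Qed.

Lemma cvg_dot a b : l2 a -> l2 b ->
  \sum_(i <- (B : {fset I})) a i * (b i)^* @[B --> finsets] --> dot a b.
Proof.
move=> [M aM] [N bN]; apply: (@cvg_asum _ (M + N)) => B.
apply: le_trans (lerD (aM B) (bN B)); rewrite -big_split /=.
apply: ler_sum => i _; rewrite normrM norm_conjC.
have xy : `|a i| * `|b i| <= 2 * (`|a i| * `|b i|).
  by rewrite ler_peMl ?mulr_ge0// ler1n.
apply: le_trans xy _; rewrite -subr_ge0.
rewrite (_ : _ - _ = (`|a i| - `|b i|) ^+ 2); last by ring.
by rewrite real_exprn_even_ge0// rpredB// normr_real.
Qed.

Lemma dot_linl k a b c : l2 a -> l2 b -> l2 c ->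
  dot (k *: a + b) c = k * dot a c + dot b c.
Proof.
move=> la lb lc; apply: (cvg_limit_unique (cvg_dot (l2_lin k la lb) lc)).
apply: cvg_ext (cvgD (cvgM (cvg_cst k) (cvg_dot la lc)) (cvg_dot lb lc)) => B.
rewrite -[LHS]/(_ * _ + _) mulr_sumr -big_split /=.
by apply: eq_bigr => i _; rewrite mulrA -mulrDl.
Qed.

Lemma dotC a b : l2 a -> l2 b -> dot a b = (dot b a)^*.
Proof.
move=> la lb; apply: (cvg_limit_unique (cvg_dot la lb)).
apply: cvg_ext (cvg_conj (cvg_dot lb la)) => B; rewrite rmorph_sum /=.
by apply: eq_bigr => i _; rewrite rmorphM /= conjCK mulrC.
Qed.

Lemma dot0r a : dot a 0 = 0.
Proof.
apply/cvg_lim; first exact: norm_hausdorff.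
apply: cvg_near_cst; apply: nearW => B.
by rewrite big1// => i _; rewrite conjC0 mulr0.
Qed.

Lemma dot_norm2 a : dot a a = asum (fun i => `|a i| ^+ 2).
Proof. by congr asum; apply/funext => i; rewrite normCK. Qed.

Lemma l2le_dot a : l2 a -> l2le a (dot a a).
Proof.
by move=> [M aM] B; rewrite dot_norm2; apply: (asum_ge_partial _ _ aM) => i; rewrite exprn_ge0.
Qed.

Lemma dot_le a M : l2le a M -> dot a a <= M.
Proof.
by move=> aM; rewrite dot_norm2; apply: asum_le => // i; rewrite exprn_ge0.
Qed.

Lemma dot_eq0 a : l2 a -> dot a a = 0 -> a = 0.
Proof.
move=> la a0; apply/funext => i; have := l2le_dot la [fset i]%fset.
rewrite a0 big_seq_fset1 => ai; apply/eqP; rewrite -normr_eq0 -sqrf_eq0.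
by rewrite eq_le ai exprn_ge0.
Qed.

Lemma l2le_tail a (e : C) : l2 a -> 0 < e -> exists A : {fset I},
  l2le (fun i => if i \in A then 0 else a i) e.
Proof.
move=> la e0; have := cvg_dot la la => /cvgrPdist_lt/(_ _ e0)[A _ /(_ A) AP].
exists A => B; pose t i := if i \in A then 0 else a i.
have /= {}AP := AP (fsubset_refl A).
have sA : \sum_(i <- A) a i * (a i)^* = \sum_(i <- A) `|a i - t i| ^+ 2.
  rewrite big_seq [RHS]big_seq; apply: eq_bigr => i iA.
  by rewrite /t iA subr0 normCK.
have {}AP : dot a a < \sum_(i <- A) `|a i - t i| ^+ 2 + e.
  rewrite -sA -ltrBlDl; apply: le_lt_trans AP; rewrite real_ler_norm//.
  rewrite ger0_real// subr_ge0; under eq_bigr do rewrite -normCK.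
  exact: l2le_dot.
(* The head [a - t] and the tail [t] have disjoint supports, so the head over [A] and the tail over
   [B] together stay below [dot a a]; the head alone already exceeds [dot a a - e]. *)
have AB := @ler_sum_fsubset C I (fun i => `|a i - t i| ^+ 2) A (A `|` B)%fset.
have BA := @ler_sum_fsubset C I (fun i => `|t i| ^+ 2) B (A `|` B)%fset.
have := lerD (AB (fun i => exprn_ge0 _ (normr_ge0 _)) (fsubsetUl _ _))
  (BA (fun i => exprn_ge0 _ (normr_ge0 _)) (fsubsetUr _ _)).
rewrite -big_split /= => h.
have h' : \sum_(i <- (A `|` B)%fset) (`|a i - t i| ^+ 2 + `|t i| ^+ 2) <= dot a a.
  apply: le_trans (l2le_dot la (A `|` B)%fset); apply: ler_sum => i _.
  by rewrite /t; case: ifP => _; rewrite ?subr0 ?subrr normr0 expr0n ?addr0 ?add0r.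
by have /ltW := le_lt_trans (le_trans h h') AP; rewrite lerD2l.
Qed.

(** Fatou's lemma: every instance of the bound is about a finite sum, and finite sums pass to the
    pointwise limit. *)
Lemma l2le_cvg (T : Type) (F : set_system T) (f : T -> I -> C) a (M : C)
    {FF : ProperFilter F} :
  (forall i, f x i @[x --> F] --> a i) -> (\forall x \near F, l2le (f x) M) ->
  l2le a M.
Proof.
move=> fa fM B.
have : \sum_(i <- B) `|f x i| ^+ 2 @[x --> F] --> \sum_(i <- B) `|a i| ^+ 2.
  by apply: cvg_sum_seq => i; exact: cvg_norm2.
move=> h; apply: (@cvg_le_le _ _ _ _ (fun=> M) _ M _ h (cvg_cst _)).
by near=> x; apply: (near fM x).
Unshelve. all: by end_near. Qed.

End SquareSummable.

Arguments l2 {R I}.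
Arguments l2_0 {R I}.

Section DotDelta.
Variables (R : realType) (I : choiceType).
Local Notation C := (Cplx R).

Definition delta (i : I) : I -> C := fun j => (i == j)%:R.

Lemma l2le_delta i : l2le (delta i) 1.
Proof.
move=> B; case: (boolP (i \in B)) => iB; last first.
  rewrite big_seq big1// => j jB; rewrite /delta.
  by case: eqVneq iB => [->|_]; rewrite ?jB// normr0 expr0n.
rewrite (big_fsetD1 i iB)/= /delta eqxx normr1 expr1n big_seq big1 ?addr0// => j.
by rewrite !inE eq_sym => /andP[/negPf -> _]; rewrite normr0 expr0n.
Qed.

Lemma dot_finsupp (A : {fset I}) (a b : I -> C) : l2 a -> l2 b ->
  (forall i, i \notin A -> a i = 0) -> dot a b = \sum_(i <- A) a i * (b i)^*.
Proof.
move=> la lb aA; apply: (cvg_limit_unique (cvg_dot la lb)); apply: cvg_near_cst.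
exists A => // B /= AB; rewrite (big_fsetID _ (mem A) B) /=.
rewrite (_ : [fset x in B | x \in A]%fset = A); last first.
  by apply/fsetP => x; rewrite !inE /= andb_idl//; apply/fsubsetP.
rewrite [X in _ + X]big1_seq ?addr0// => i.
by rewrite !inE /= => /andP[_ /aA ->]; rewrite mul0r.
Qed.

Lemma dot_delta i (a : I -> C) : l2 a -> dot (delta i) a = (a i)^*.
Proof.
move=> la; rewrite (@dot_finsupp [fset i]%fset) ?big_seq_fset1//.
- by rewrite /delta eqxx mul1r.
- by exists 1; exact: l2le_delta.
- by move=> j; rewrite inE eq_sym /delta => /negPf ->.
Qed.

End DotDelta.

Section DotTensor.
Variables (R : realType) (I J : choiceType).
Local Notation C := (Cplx R).
Implicit Types (a c : I -> C) (b d : J -> C).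

Definition ftens a b : I * J -> C := fun p => a p.1 * b p.2.

Lemma l2le_ftens a b M N : l2le a M -> l2le b N -> l2le (ftens a b) (M * N).
Proof.
move=> aM bN B.
apply: le_trans (@ler_sum_fst C I J B (fun i j => `|a i * b j| ^+ 2)
  (fun i => `|a i| ^+ 2 * N) _ _) _.
- by move=> i j; rewrite exprn_ge0.
- move=> i J0; under eq_bigr do rewrite normrM exprMn.
  by rewrite -mulr_sumr ler_wpM2l// exprn_ge0.
- by rewrite -mulr_suml ler_wpM2r//; exact: l2le_ge0 bN.
Qed.

Lemma l2_ftens a b : l2 a -> l2 b -> l2 (ftens a b).
Proof. by move=> [M aM] [N bN]; exists (M * N); exact: l2le_ftens. Qed.

(** Rectangles are cofinal among the finite subsets of the product, so a sum over pairs may be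
    computed along rectangles, where it factors. *)
Lemma cvg_fsetM : (p.1 `*` p.2)%fset @[p --> filter_prod (@finsets I) (@finsets J)]
  --> (@finsets (I * J)%type).
Proof.
move=> P [A _ AP]; exists ([set B | [fset p.1 | p in A] `<=` B]%fset,
  [set B | [fset p.2 | p in A] `<=` B]%fset).
  by split; [exists [fset p.1 | p in A]%fset|exists [fset p.2 | p in A]%fset].
move=> [B1 B2] /= [/fsubsetP h1 /fsubsetP h2]; apply: AP => /=.
apply/fsubsetP => -[i j] ijA; rewrite in_fsetM /=; apply/andP; split.
- by apply: h1; apply/imfsetP; exists (i, j).
- by apply: h2; apply/imfsetP; exists (i, j).
Qed.

Lemma dot_ftens a b c d : l2 a -> l2 b -> l2 c -> l2 d ->
  dot (ftens a b) (ftens c d) = dot a c * dot b d.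
Proof.
move=> la lb lc ld.
have h := cvg_dot (l2_ftens la lb) (l2_ftens lc ld).
have {}h := cvg_comp _ _ cvg_fsetM h.
apply: (cvg_limit_unique h).
have h1 : \sum_(i <- (p.1 : {fset I})) a i * (c i)^*
    @[p --> filter_prod (@finsets I) (@finsets J)] --> dot a c.
  exact: cvg_comp (cvg_fst) (cvg_dot la lc).
have h2 : \sum_(j <- (p.2 : {fset J})) b j * (d j)^*
    @[p --> filter_prod (@finsets I) (@finsets J)] --> dot b d.
  exact: cvg_comp (cvg_snd) (cvg_dot lb ld).
apply: cvg_ext (cvgM h1 h2) => -[B1 B2].
rewrite -[LHS]/(_ * _) big_distrlr /= [RHS]big_imfset2 //=; last first.
  by move=> [x y] [x' y'] _ _ /= [-> ->].
apply: eq_bigr => i _; apply: eq_bigr => j _.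
by rewrite /ftens /= rmorphM /= mulrACA.
Qed.

End DotTensor.

(** * Closed subspaces of l^2 as Hilbert spaces *)

Section DotInequalities.
Variables (C : numClosedFieldType) (U : lmodType C) (form : {dot U for conjC}).
Local Notation "''[' u , v ]" := (form u%R v%R) : ring_scope.
Local Notation "''[' u ]" := '[u, u]%R : ring_scope.

Lemma dnormBZ a u v :
  '[u - a *: v] = '[u] - (a^* * '[u, v] + a * ('[u, v])^*) + `|a| ^+ 2 * '[v].
Proof.
rewrite dnormB dnormZ linearZr_LR /= rmorphM /= conjCK.
by rewrite -!addrA; congr (_ + _); rewrite addrC.
Qed.

Lemma dot_CauchySchwarz u v : `|'[u, v]| ^+ 2 <= '[u] * '[v].
Proof.
have [->|v0] := eqVneq v 0; first by rewrite !linear0r normr0 expr0n.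
have vv : 0 < '[v] by rewrite dnorm_gt0.
have := dnorm_ge0 form (u - ('[u, v] / '[v]) *: v).
rewrite dnormBZ normrM exprMn normfV (gtr0_norm vv) rmorphM fmorphV /=.
have -> : ('[v])^* = '[v] by rewrite geC0_conj// ltW.
rewrite normCK => h; rewrite -subr_ge0.
have -> : '[u] * '[v] - '[u, v] * ('[u, v])^* = '[v] * ('[u] -
   (('[u, v])^* / '[v] * '[u, v] + '[u, v] / '[v] * ('[u, v])^*) +
      '[u, v] * ('[u, v])^* * ('[v]^-1) ^+ 2 * '[v]).
  by field; rewrite gt_eqF.
by rewrite mulr_ge0// ltW.
Qed.

Lemma dot_CauchySchwarz_sqrt u v : `|'[u, v]| <= sqrtC '[u] * sqrtC '[v].
Proof.
rewrite -(@ler_pXn2r _ 2)// ?nnegrE// ?mulr_ge0 ?sqrtC_ge0//.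
by rewrite exprMn !sqrtCK dot_CauchySchwarz.
Qed.

Lemma dot_triangle u v : sqrtC '[u + v] <= sqrtC '[u] + sqrtC '[v].
Proof.
rewrite -(@ler_pXn2r _ 2)// ?nnegrE// ?addr_ge0 ?sqrtC_ge0//.
rewrite sqrrD !sqrtCK dnormD [leRHS]addrAC lerD2l.
have -> : '[u, v] + ('[u, v])^* = 'Re '[u, v] *+ 2.
  by rewrite ReE -mulr_natr divfK// pnatr_eq0.
rewrite lerMn2r /=; apply: le_trans (dot_CauchySchwarz_sqrt u v).
by rewrite leif_Re_Creal.
Qed.

Lemma dot_sqrtZ k u : sqrtC '[k *: u] = `|k| * sqrtC '[u].
Proof. by rewrite dnormZ rootCMl ?exprn_ge0// sqrCK. Qed.

End DotInequalities.

Section L2Subspace.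
Variables (R : realType) (I : choiceType).
Local Notation C := (Cplx R).

(** The last field is closedness for the l^2 distance, with [e] bounding its square. *)
Record l2closed (S : set (I -> C)) : Prop := L2Closed {
  l2closed_l2 : S `<=` l2 ;
  l2closed0 : S 0 ;
  l2closed_lin : forall k a b, S a -> S b -> S (k *: a + b) ;
  l2closed_lim : forall a, l2 a ->
    (forall e : C, 0 < e -> exists2 b, S b & l2le (a - b) e) -> S a }.

Variables (S : set (I -> C)) (hS : l2closed S).

(** Indexing the predicate by the proof of closedness lets the submodule and Hilbert space
    structures be attached for every closed [S] at once. *)
Definition l2pred of l2closed S : {pred I -> C} := fun a => `[< S a >].
Local Notation P := (l2pred hS).

Lemma l2predP a : (a \in P) <-> S a.
Proof. by rewrite /l2pred unfold_in; split => /asboolP. Qed.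

Lemma l2pred_submod : GRing.subsemimod_closed P.
Proof.
split; first split.
- by apply/l2predP; exact: l2closed0 hS.
- move=> a b /l2predP Sa /l2predP Sb; apply/l2predP.
  by rewrite -[a]scale1r; exact: l2closed_lin.
- move=> k a /l2predP Sa; apply/l2predP; rewrite -[_ *: _]addr0.
  by apply: l2closed_lin => //; exact: l2closed0 hS.
Qed.

HB.instance Definition _ := GRing.isSubmodClosed.Build C (I -> C) P l2pred_submod.

Record l2space := L2Space { l2val : I -> C ; _ : l2val \in P }.
HB.instance Definition _ := [isSub for l2val].
HB.instance Definition _ := [Choice of l2space by <:].
HB.instance Definition _ := [SubChoice_isSubLmodule of l2space by <:].

Lemma l2valP (u : l2space) : S (l2val u).
Proof. by apply/l2predP; exact: (valP u). Qed.

Lemma l2val_l2 (u : l2space) : l2 (l2val u).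
Proof. by apply: (l2closed_l2 hS); exact: l2valP. Qed.

Definition l2inner (u v : l2space) : C := dot (l2val u) (l2val v).

Lemma l2innerC u v : l2inner u v = (l2inner v u)^*.
Proof. by apply: dotC; exact: l2val_l2. Qed.

Lemma l2inner_linl v : GRing.linear_for *%R (l2inner^~ v).
Proof.
by move=> k a b; rewrite /l2inner -dot_linl//; exact: l2val_l2.
Qed.

Lemma l2inner_bilinear : bilinear_for *%R (conjC \; *%R) l2inner.
Proof.
split => [v|u]; first exact: l2inner_linl.
move=> k a b; rewrite [LHS]l2innerC l2inner_linl rmorphD rmorphM /=.
by rewrite -!l2innerC.
Qed.

HB.instance Definition _ := bilinear_isBilinear.Build C l2space l2space C
  *%R (conjC \; *%R) l2inner l2inner_bilinear.

Lemma l2inner_herm u v : l2inner u v = (-1) ^+ false * (l2inner v u)^*.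
Proof. by rewrite expr0 mul1r l2innerC. Qed.

HB.instance Definition _ := isHermitianSesquilinear.Build C l2space
  false conjC l2inner l2inner_herm.

Lemma l2inner_gt0 u : u != 0 -> 0 < l2inner u u.
Proof.
move=> u0; rewrite lt_neqAle; apply/andP; split; last first.
  exact: l2le_ge0 (l2le_dot (l2val_l2 u)).
apply: contra u0 => /eqP/esym u0; apply/eqP/val_inj => /=.
by apply: dot_eq0 => //; exact: l2val_l2.
Qed.

HB.instance Definition _ := isDotProduct.Build C l2space l2inner l2inner_gt0.

Definition l2norm (u : l2space) : C := sqrtC (l2inner u u).

Lemma l2norm_eq0 u : l2norm u = 0 -> u = 0.
Proof.
by move=> /eqP; rewrite sqrt_dnorm_eq0 => /eqP.
Qed.

HB.instance Definition _ := Lmodule_isNormed.Build C l2space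
  (dot_triangle l2inner) (dot_sqrtZ l2inner) l2norm_eq0.

Lemma l2space_normE (u : l2space) : `|u| = sqrtC (dot (l2val u) (l2val u)).
Proof. by []. Qed.

Lemma l2space_norm2 (u : l2space) : `|u| ^+ 2 = dot (l2val u) (l2val u).
Proof. by rewrite l2space_normE sqrtCK. Qed.

Lemma l2le_norm (u : l2space) : l2le (l2val u) (`|u| ^+ 2).
Proof. by rewrite l2space_norm2; apply: l2le_dot; exact: l2val_l2. Qed.

Lemma norm_l2le (u : l2space) (e : C) : 0 <= e -> l2le (l2val u) (e ^+ 2) -> `|u| <= e.
Proof.
move=> e0 ue; rewrite -(@ler_pXn2r _ 2)// ?nnegrE//.
by rewrite l2space_norm2; exact: dot_le.
Qed.

Lemma norm_l2val (u : l2space) i : `|l2val u i| <= `|u|.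
Proof.
rewrite -(@ler_pXn2r _ 2)// ?nnegrE//.
by have := l2le_norm u [fset i]%fset; rewrite big_seq_fset1.
Qed.

Lemma l2valB u v : l2val (u - v) = l2val u - l2val v.
Proof. by have := raddfB (\val : l2space -> (I -> C)) u v; apply. Qed.

Lemma l2le_distC (a b : I -> C) (e : C) : l2le (a - b) e -> l2le (b - a) e.
Proof.
move=> h B; apply: le_trans (h B); apply: ler_sum => i _.
by rewrite -[(b - a) i]/(b i - a i) distrC.
Qed.

(** The coordinates are 1-Lipschitz and hence converge; [l2le_cvg] turns the Cauchy estimate into an
    l^2 estimate against the coordinatewise limit, and closedness brings that limit back into
    [S]. *)
Lemma l2space_complete (F : set_system l2space) :
  ProperFilter F -> cauchy F -> cvg F.
Proof.
move=> FF /cauchy_ballP Fc.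
have {}Fc (e : C) : 0 < e ->
    exists2 D, F D & forall u v, D u -> D v -> `|u - v| < e.
  move=> /Fc[[A B] /= [FA FB] AB]; exists (A `&` B); first exact: filterI.
  by move=> u v [Au Bu] [Av Bv]; have := AB (u, v); rewrite -ball_normE; apply.
have lim_i i : exists l : C, l2val u i @[u --> F] --> l.
  apply: Cplx_complete; apply/cauchy_ballP => e e0.
  have [D FD De] := Fc _ e0.
  pose E := (l2val^~ i) @` D.
  have FE : F [set u | E (l2val u i)] by apply: filterS FD => u Du; exists u.
  exists (E, E) => // -[_ _] /= [[u Du <-] [v Dv <-]].
  rewrite -ball_normE /= -[_ - _]/((l2val u - l2val v) i) -l2valB.
  by apply: le_lt_trans (norm_l2val _ _) (De _ _ Du Dv).
have [a Fa] := choice lim_i.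
have Da (e : C) : 0 < e ->
    exists2 D, F D & forall u, D u -> l2le (l2val u - a) (e ^+ 2).
  move=> e0; have [D FD De] := Fc _ e0; exists D => // u Du.
  apply: (@l2le_cvg _ _ _ F (fun v => l2val u - l2val v)).
    by move=> i; apply: cvgB; [exact: cvg_cst|exact: Fa].
  apply: filterS FD => v Dv B; rewrite -l2valB.
  apply: le_trans (l2le_norm _ B) _.
  by rewrite lerXn2r ?nnegrE ?normr_ge0 ?(ltW e0)// ltW// De.
have la : l2 a.
  have [D FD De] := Da 1 ltr01; have [u Du] := filter_ex FD.
  rewrite -[a](subKr (l2val u)); apply: l2B; first exact: l2val_l2.
  by exists (1 ^+ 2); exact: De.
have Sa : S a.
  apply: (l2closed_lim hS la) => e e0.
  have [|D FD De] := Da (sqrtC e); first by rewrite sqrtC_gt0.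
  have [u Du] := filter_ex FD; exists (l2val u); first exact: l2valP.
  by apply: l2le_distC; rewrite -[e]sqrtCK; exact: De.
have aP : a \in P by apply/l2predP.
apply/cvg_ex; exists (L2Space aP); apply/cvgrPdist_le => e e0.
have [D FD De] := Da _ e0; apply: filterS FD => u Du.
rewrite distrC; apply: norm_l2le; first exact: ltW.
by rewrite l2valB; exact: De.
Qed.

HB.instance Definition _ := Uniform_isComplete.Build l2space l2space_complete.

Definition l2hilbert : hilbertSpace R :=
  @HilbertSpace R l2space l2inner l2space_norm2.

End L2Subspace.

Section DotCauchySchwarz.
Variables (R : realType) (I : choiceType).
Local Notation C := (Cplx R).

Lemma l2closed_full : l2closed (l2 : set (I -> C)).
Proof.
split=> //; first exact: l2_0.
by move=> k a b; exact: l2_lin.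
Qed.

Lemma l2_CauchySchwarz (a b : I -> C) : l2 a -> l2 b ->
  `|dot a b| <= sqrtC (dot a a) * sqrtC (dot b b).
Proof.
move=> la lb.
pose u := L2Space ((l2predP l2closed_full a).2 la).
pose v := L2Space ((l2predP l2closed_full b).2 lb).
exact: (@dot_CauchySchwarz_sqrt _ _ (@l2inner _ _ _ l2closed_full) u v).
Qed.

End DotCauchySchwarz.

(** * The Riesz representation theorem *)

Section RealPart.
Variable R : realType.
Local Notation C := (Cplx R).

Lemma reC_ofRM (t : R) (z : C) : reC (ofR t * z) = t * reC z.
Proof.
Local Transparent Cplx.
by case: z => a b; rewrite /reC /ofR /= mul0r subr0.
Local Opaque Cplx.
Qed.

Lemma reC_conj (z : C) : reC (z^*) = reC z.
Proof.
Local Transparent Cplx.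
by case: z => a b; rewrite /reC.
Local Opaque Cplx.
Qed.

Definition imC (z : C) : R := complex.Im z.

Lemma ofR_imC0 (z : C) : imC z = 0 -> z = ofR (reC z).
Proof.
Local Transparent Cplx.
by case: z => a b; rewrite /imC /reC /ofR /= => ->.
Local Opaque Cplx.
Qed.

Lemma reC_sqrB (z : C) (r : R) :
  reC ((z - ofR r) ^+ 2) = (reC z - r) ^+ 2 - imC z ^+ 2.
Proof.
Local Transparent Cplx.
case: z => a b; rewrite /reC /imC /ofR expr2 /= oppr0 addr0; ring.
Local Opaque Cplx.
Qed.

Lemma reC_sum (I : Type) (r : seq I) (F : I -> C) :
  reC (\sum_(i <- r) F i) = \sum_(i <- r) reC (F i).
Proof. by apply: big_morph => //; exact: reCD. Qed.

Lemma ofR_sum (I : Type) (r : seq I) (F : I -> R) :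
  ofR (\sum_(i <- r) F i) = \sum_(i <- r) ofR (F i).
Proof. by apply: big_morph => //; exact: ofRD. Qed.

Lemma ofR_real (x : R) : ofR x \is Num.real.
Proof. by rewrite realE (_ : 0 = ofR 0)// !ofR_le le_total. Qed.

Lemma eq_reC (z w : C) : reC z = reC w -> reC (- 'i * z) = reC (- 'i * w) -> z = w.
Proof. by move=> h1 h2; rewrite (reC_decomp z) h1 h2 -reC_decomp. Qed.

End RealPart.

Section Riesz.
Variables (R : realType) (H : hilbertSpace R).
Local Notation C := (Cplx R).
Local Notation "<< u , v >>" := (inner H u v).

Lemma hilbert_CauchySchwarz (u v : H) : `| << u, v >> | <= `|u| * `|v|.
Proof.
have nE (w : H) : `|w| = sqrtC << w, w >>.
  by apply/esym; rewrite -inner_norm sqrCK.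
by rewrite !nE; exact: dot_CauchySchwarz_sqrt.
Qed.

Lemma inner_injr (v w : H) : (forall u, << u, v >> = << u, w >>) -> v = w.
Proof.
move=> vw; apply/eqP; rewrite -subr_eq0 -(dnorm_eq0 (inner H)).
by rewrite linearBr /= vw subrr.
Qed.

Variables (phi : H -> C) (phi_scalar : scalar phi) (M : C) (M0 : 0 <= M).
Hypothesis phiM : forall u, `|phi u| <= M * `|u|.

Let N (u : H) : R := reC (`|u| ^+ 2).
Let p (u : H) : R := reC (phi u).
Let q (u v : H) : R := reC << u, v >>.
Let J (u : H) : R := N u - 2 * p u.

Let phiD : {morph phi : u v / u + v}.
Proof. by move=> u v; have := phi_scalar 1 u v; rewrite scale1r mul1r. Qed.

Let phi0 : phi 0 = 0.
Proof.
have := phi_scalar 1 0 0; rewrite scale1r mul1r addr0 => h.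
by apply: (addrI (phi 0)); rewrite -h addr0.
Qed.

Let phiZ k u : phi (k *: u) = k * phi u.
Proof. by rewrite -[k *: u]addr0 phi_scalar phi0 addr0. Qed.

Let phiB : {morph phi : u v / u - v}.
Proof. by move=> u v; rewrite phiD -scaleN1r phiZ mulN1r. Qed.

Let pD : {morph p : u v / u + v}.
Proof. by move=> u v; rewrite /p phiD reCD. Qed.

Let pZ t u : p (ofR t *: u) = t * p u.
Proof. by rewrite /p phiZ reC_ofRM. Qed.

Let N_ge0 u : 0 <= N u.
Proof. by rewrite -ofR_le ofR_reC ?exprn_ge0// realE exprn_ge0. Qed.

Let ND u v : N (u + v) = N u + N v + 2 * q u v.
Proof.
rewrite /N inner_norm dnormD !reCD reC_conj -!inner_norm /q; ring.
Qed.

Let NZ t u : N (ofR t *: u) = t ^+ 2 * N u.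
Proof.
rewrite /N normrZ exprMn ofR_norm expr2 -mulrA !reC_ofRM mulrA -normrM -expr2.
by rewrite ger0_norm// sqr_ge0.
Qed.

Let qZr t u v : q u (ofR t *: v) = t * q u v.
Proof.
by rewrite /q linearZr_LR /= conj_Creal ?ofR_real// reC_ofRM.
Qed.

Let J_bound u : - (reC M) ^+ 2 <= J u.
Proof.
have nr : ofR (reC `|u|) = `|u| by rewrite ofR_reC.
have NE : N u = reC `|u| ^+ 2 by rewrite /N -{1}nr expr2 reC_ofRM -expr2.
have h : `|p u| <= reC M * reC `|u|.
  rewrite -ofR_le ofRM nr ofR_reC ?realE ?M0//.
  exact: le_trans (norm_reC _) (phiM u).
have := sqr_ge0 (reC `|u| - reC M); move: h; rewrite ler_norml /J NE sqrrB.
by move=> /andP[]; lra.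
Qed.

Let m0 := inf (range J).

Let J_inf : has_inf (range J).
Proof.
split; first by exists (J 0), 0.
by exists (- (reC M) ^+ 2) => _ [u _ <-].
Qed.

Let m0_le u : m0 <= J u.
Proof. by apply: ge_inf; [exact: J_inf.2|exists u]. Qed.

(** The parallelogram law, with [m0] bounding [J] at the midpoint of [u] and [v]: two almost
    minimizers are close to each other. *)
Let J_parallelogram u v : N (u - v) + 4 * m0 <= 2 * J u + 2 * J v.
Proof.
have -> : N (u - v) = N (u + ofR (-1) *: v) by rewrite /ofR rmorphN1 scaleN1r.
have := m0_le (ofR (2^-1) *: (u + v)); rewrite /J NZ pZ !ND pD NZ qZr; lra.
Qed.

Let minimizing : set_system H :=
  filter_from [set e : R | 0 < e] (fun e => [set u | J u < m0 + e]).

Let minimizing_filter : ProperFilter minimizing.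
Proof.
apply: filter_from_proper.
  apply: filter_from_filter; first by exists 1 => /=.
  move=> e f /= e0 f0; exists (Num.min e f); first by rewrite /= lt_min e0.
  move=> u /= uef; split => /=; apply: lt_le_trans uef _; rewrite lerD2l.
    by rewrite ge_min lexx.
  by rewrite ge_min lexx orbT.
move=> e /= e0; have [_ [u _ <-] uJ] := inf_adherent e0 J_inf.
by exists u.
Qed.

Existing Instance minimizing_filter.

Let minimizing_cauchy : cauchy minimizing.
Proof.
apply/cauchy_ballP => e /gt0_ofR[-> e0].
(* Two values of [J] below [m0 + d] give [N (u - v) < 4 * d], by [J_parallelogram]. *)
pose d := reC e ^+ 2 / 4; have d0 : 0 < d by rewrite divr_gt0// exprn_gt0.
pose D : set H := [set u | J u < m0 + d].
have FD : minimizing D by exists d.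
exists (D, D) => // -[u v] /= [Du Dv].
rewrite -ball_normE /=.
have : N (u - v) < reC e ^+ 2.
  by have := J_parallelogram u v; move: Du Dv; rewrite /D /d /=; lra.
have uvr : ofR (reC `|u - v|) = `|u - v| by rewrite ofR_reC.
have -> : N (u - v) = reC `|u - v| ^+ 2 by rewrite /N -{1}uvr expr2 reC_ofRM -expr2.
rewrite -uvr ofR_lt ltr_pXn2r ?nnegrE ?(ltW e0)//.
by rewrite reC_ofR reC_ge0.
Qed.

(* The representer minimizes [|u|^2 - 2 Re (phi u)]. *)
Theorem riesz_representation : exists v : H, forall u, phi u = << u, v >>.
Proof.
have : cvg minimizing by exact: cauchy_cvg minimizing_cauchy.
move=> /cvg_ex[v Fv0].
have Fv : u @[u --> minimizing] --> v by exact: Fv0.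
have phiv : phi u @[u --> minimizing] --> phi v.
  apply/cvgrPdist_lt => e e0; have M1 : 0 < M + 1 by rewrite ltr_wpDl.
  move/cvgrPdist_lt : Fv => /(_ (e / (M + 1))).
  rewrite divr_gt0// => /(_ isT) Fe; near=> u.
  rewrite -phiB; apply: le_lt_trans (phiM _) _.
  apply: (@le_lt_trans _ _ ((M + 1) * `|v - u|)).
    by rewrite ler_wpM2r// lerDl.
  by rewrite mulrC -ltr_pdivlMr//; near: u.
have JvE : J v <= m0.
  have Jc : J u @[u --> minimizing] --> J v.
    apply: cvgB.
      by apply: cvg_reC; rewrite !expr2; apply: cvgM; exact: cvg_norm.
    by apply: cvgM; [exact: cvg_cst|exact: cvg_reC].
  apply/ler_addgt0Pr => e e0; have e20 : 0 < e / 2 by rewrite divr_gt0.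
  near minimizing => u.
  have : `|J v - J u| < e / 2 by near: u; move/cvgrPdist_lt : Jc; apply.
  have : J u < m0 + e / 2 by near: u; exists (e / 2).
  by rewrite ltr_norml => ? /andP[]; lra.
have qp h : q v h = p h.
  have key t : 0 <= t ^+ 2 * N h + 2 * t * (q v h - p h).
    have := le_trans JvE (m0_le (v + ofR t *: h)).
    by rewrite /J ND NZ pD pZ qZr; lra.
  (* By [key] a quadratic polynomial in [t] is nonnegative; at [t = - b / s] it is a negative
     multiple of [b ^+ 2]. The summand 1 in [s] keeps the divisor positive. *)
  pose b := q v h - p h; pose s := N h + 1.
  have s0 : 0 < s by rewrite ltr_wpDl.
  apply/eqP; rewrite -subr_eq0 -/b; apply/eqP.
  have := key (- b / s); rewrite -/b.
  have -> : (- b / s) ^+ 2 * N h + 2 * (- b / s) * b = - (b ^+ 2 * (N h + 2) / s ^+ 2).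
    by rewrite (_ : N h = s - 1) /s ?addrK//; field; rewrite gt_eqF.
  rewrite oppr_ge0 pmulr_lle0 ?invr_gt0 ?exprn_gt0// pmulr_lle0 ?ltr_wpDl// => b2.
  by apply/eqP; rewrite -sqrf_eq0 eq_le b2 sqr_ge0.
have qpC h : reC (phi h) = reC << h, v >>.
  by rewrite -[LHS]qp /q hermC mul1r reC_conj.
(* The real parts of the two functionals agree everywhere; their values at [- 'i *: h] give the
   imaginary parts at [h]. *)
exists v => h; apply: eq_reC => //.
by rewrite -phiZ qpC linearZl_LR.
Unshelve. all: by end_near. Qed.

End Riesz.

Section FieldIdentities.
Variable K : numFieldType.

Lemma quarterE (x e : K) : x + 1 != 0 -> e / 4 = (x + 1) * (e / (4 * (x + 1))).
Proof. by move=> x1; field. Qed.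

Lemma twice_quarters (e : K) : 2 * (e / 4 + e / 4) = e.
Proof. by field. Qed.

Lemma thirdsE (e : K) : e = e / 3 + e / 3 + e / 3.
Proof. by field. Qed.

End FieldIdentities.

(** * Closed linear spans in l^2 *)

Section ClosedSpan.
Variables (R : realType) (I : choiceType).
Local Notation C := (Cplx R).
Variable G : set (I -> C).

Inductive lspan : set (I -> C) :=
| lspan0 : lspan 0
| lspan_cons k a b : G a -> lspan b -> lspan (k *: a + b).

Lemma lspan_lin k a b : lspan a -> lspan b -> lspan (k *: a + b).
Proof.
elim=> [|l c d Gc _ ih] sb; first by rewrite scaler0 add0r.
by rewrite scalerDr scalerA -addrA; apply: lspan_cons => //; exact: ih.
Qed.

Lemma lspan_gen a : G a -> lspan a.
Proof.
by move=> Ga; rewrite -[a]addr0 -[a]scale1r; apply: lspan_cons => //; exact: lspan0.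
Qed.

Definition clspan : set (I -> C) :=
  [set a | l2 a /\ forall e : C, 0 < e -> exists2 b, lspan b & l2le (a - b) e].

Lemma clspan_lspan a : l2 a -> lspan a -> clspan a.
Proof.
move=> la sa; split=> // e e0; exists a => // B.
by rewrite subrr big1 ?ltW// => i _; rewrite normr0 expr0n.
Qed.

Hypothesis Gl2 : G `<=` l2.

Lemma lspan_l2 : lspan `<=` l2.
Proof.
move=> a; elim=> [|k c d Gc _ ld]; first exact: l2_0.
by apply: l2_lin => //; exact: Gl2.
Qed.

Lemma clspan_closed : l2closed clspan.
Proof.
split=> [a []//| | |].
- by apply: clspan_lspan; [exact: l2_0|exact: lspan0].
- move=> k a b [la Ca] [lb Cb]; split; first exact: l2_lin.
  move=> e e0; pose K := 4 * (`|k| ^+ 2 + 1).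
  have K0 : 0 < K by rewrite mulr_gt0// ltr_wpDl// exprn_ge0.
  have [a' sa' aa'] := Ca (e / K) (divr_gt0 e0 K0).
  have [b' sb' bb'] := Cb (e / 4) (divr_gt0 e0 (ltr0n _ 4)).
  exists (k *: a' + b'); first exact: lspan_lin.
  have -> : k *: a + b - (k *: a' + b') = k *: (a - a') + (b - b').
    by rewrite scalerBr opprD addrACA.
  move=> B; apply: le_trans (l2leD (l2leZ k aa') bb' B) _.
  have k1 : `|k| ^+ 2 * (e / K) <= e / 4.
    rewrite (@quarterE _ (`|k| ^+ 2)); last by rewrite gt_eqF// ltr_wpDl// exprn_ge0.
    by rewrite ler_wpM2r ?lerDl// divr_ge0 ?ltW.
  apply: le_trans (_ : 2 * (e / 4 + e / 4) <= _); first by rewrite ler_wpM2l// lerD2r.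
  by rewrite twice_quarters.
- move=> a la Ca; split=> // e e0.
  have [b [lb Cb] ab] := Ca (e / 4) (divr_gt0 e0 (ltr0n _ 4)).
  have [c sc bc] := Cb (e / 4) (divr_gt0 e0 (ltr0n _ 4)).
  exists c => // B; rewrite -(subrKA b a (- c)).
  apply: le_trans (l2leD ab bc B) _.
  by rewrite twice_quarters.
Qed.

Definition spanH : hilbertSpace R := l2hilbert clspan_closed.

Definition mkspan (a : I -> C) (Ca : clspan a) : spanH :=
  L2Space ((l2predP clspan_closed a).2 Ca).

Lemma spanH_l2 (u : spanH) : l2 (l2val u).
Proof. exact: l2val_l2. Qed.

Lemma spanH_approx (u : spanH) (e : C) : 0 < e ->
  exists2 b : spanH, lspan (l2val b) & `|u - b| < e.
Proof.
move=> e0; have [_] := l2valP u; move=> /(_ ((e / 2) ^+ 2)).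
rewrite exprn_gt0 ?divr_gt0// => /(_ isT)[b sb ub].
exists (mkspan (clspan_lspan (lspan_l2 sb) sb)) => //.
apply: (@le_lt_trans _ _ (e / 2)); last first.
  by rewrite ltr_pdivrMr// mulr_natr mulr2n ltrDl.
by apply: norm_l2le; [rewrite divr_ge0// ltW|rewrite l2valB].
Qed.

(** If [u] is nonzero, some [b] in the span of the generators is closer to [u] than [|u|], and
    orthogonality gives [|u| ^+ 2 = <u, u - b> < |u| ^+ 2]. *)
Lemma spanH_orthogonal (u : spanH) :
  (forall g : spanH, G (l2val g) -> inner spanH u g = 0) -> u = 0.
Proof.
move=> ug.
have us (b : I -> C) : lspan b -> dot (l2val u) b = 0.
  elim => [|k a c Ga sc ih]; first exact: dot0r.
  have la := Gl2 Ga; have lc := lspan_l2 sc.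
  rewrite dotC//; [|exact: spanH_l2|exact: l2_lin].
  rewrite dot_linl//; last exact: spanH_l2.
  rewrite rmorphD rmorphM /= -!dotC// ?ih ?addr0; try exact: spanH_l2.
  have := ug (mkspan (clspan_lspan la (lspan_gen Ga))) Ga.
  by rewrite /inner /= /l2inner /= => ->; rewrite mulr0.
apply/eqP; rewrite -normr_eq0; apply/negPn/negP => u0.
have {}u0 : 0 < `|u| by rewrite lt_def u0 normr_ge0.
have [b sb ub] := spanH_approx u u0.
have : `|u| ^+ 2 <= `|u| * `|u - b|.
  rewrite -[leLHS]ger0_norm ?exprn_ge0// inner_norm.
  have -> : inner spanH u u = inner spanH u (u - b).
    by rewrite linearBr /= (_ : inner spanH u b = 0) ?subr0//; exact: us.
  exact: hilbert_CauchySchwarz.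
by rewrite expr2 ler_pM2l// => /(lt_le_trans ub); rewrite ltxx.
Qed.

End ClosedSpan.

Arguments mkspan {R I G a} Ca.
Arguments spanH_l2 {R I G} u.
Arguments spanH_approx {R I G} Gl2 u {e}.
Arguments spanH_orthogonal {R I G} Gl2 {u}.

(** * Reproducing kernel Hilbert algebras from feature maps *)

Section FeatureRKHS.
Variables (R : realType) (X : Type) (I : choiceType).
Local Notation C := (Cplx R).
Variables (Phi : X -> I -> C) (Phi_l2 : forall x, l2 (Phi x)).

Let G : set (I -> C) := range Phi.

Lemma features_l2 : G `<=` l2.
Proof. by move=> _ [x _ <-]. Qed.

Let H : hilbertSpace R := spanH G.

Definition feature (x : X) : H :=
  mkspan (clspan_lspan (Phi_l2 x) (lspan_gen (imageT Phi x))).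

Definition feature_eval (u : H) : X -> C := fun x => inner H u (feature x).

Lemma feature_eval_linear : linear feature_eval.
Proof. by move=> k u v; apply/funext => x; rewrite /feature_eval linearPl. Qed.

HB.instance Definition _ := GRing.isLinear.Build C H (X -> C) *:%R
  feature_eval feature_eval_linear.

Lemma feature_eval_inj : injective feature_eval.
Proof.
move=> u v uv; apply/eqP; rewrite -subr_eq0; apply/eqP.
apply: (spanH_orthogonal features_l2) => g [x _ gx].
have -> : g = feature x by apply: val_inj; rewrite /= gx.
by rewrite linearBl /= -![inner H _ _]/(feature_eval _ x) uv subrr.
Qed.

Lemma bounded_functional_continuous (K : hilbertSpace R) (phi : K -> C) (M : C) :
  M \is Num.real -> scalar phi -> (forall u, `|phi u| <= M * `|u|) ->
  continuous (phi : K -> C).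
Proof.
move=> Mr phil phiM u; have phiB v : phi u - phi v = phi (u - v).
  by rewrite (_ : u - v = (-1) *: v + u) ?phil ?mulN1r ?scaleN1r addrC.
apply/cvgrPdist_lt => e e0; have M1 : 0 < `|M| + 1 by rewrite ltr_wpDl.
near=> v; rewrite phiB; apply: le_lt_trans (phiM _) _.
apply: (@le_lt_trans _ _ ((`|M| + 1) * `|u - v|)).
  rewrite ler_wpM2r//; apply: (@le_trans _ _ `|M|); last by rewrite lerDl.
  by rewrite real_ler_norm.
rewrite mulrC -ltr_pdivlMr//; near: v.
by apply: cvgr_dist_lt; rewrite ?divr_gt0//; exact: cvg_id.
Unshelve. all: by end_near. Qed.

Lemma feature_eval_continuous x :
  continuous (fun u : H => feature_eval u x : C).
Proof.
apply: (@bounded_functional_continuous _ _ `|feature x|) => //.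
  by move=> k u v; rewrite /feature_eval linearPl.
by move=> u; rewrite mulrC; exact: hilbert_CauchySchwarz.
Qed.

Definition featureRKHS : rkhs R X :=
  @RKHS R X H feature_eval feature_eval_inj feature_eval_continuous.

Lemma feature_kernel_section x : kernel_section featureRKHS x = feature x.
Proof.
rewrite /kernel_section; apply: get_unique => // v Pv.
by apply: (@inner_injr _ H) => u; exact: esym (Pv u).
Qed.

(** [v] is the orthogonal projection of [a] onto the closed span of the features: inner products
    with features are kept and the norm does not grow. Every square-summable family thus names a
    function, whether or not it lies in the span. *)
Lemma feature_represent (a : I -> C) : l2 a -> exists v : featureRKHS,
  (forall x, evalf featureRKHS v x = dot a (Phi x)) /\ `|v| <= sqrtC (dot a a).
Proof.
move=> la; pose phi (u : H) : C := dot (l2val u) a.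
have phil : scalar phi.
  by move=> k u v; rewrite /phi -dot_linl//; exact: spanH_l2.
have phiM u : `|phi u| <= sqrtC (dot a a) * `|u|.
  by rewrite mulrC; apply: l2_CauchySchwarz => //; exact: spanH_l2.
have a0 : 0 <= sqrtC (dot a a) by rewrite sqrtC_ge0; exact: l2le_ge0 (l2le_dot la).
have [v phiv] := riesz_representation phil a0 phiM.
exists v; split=> [x|].
  rewrite -[LHS]/(inner H v (feature x)) (_ : inner H v _ = (phi (feature x))^*).
    by rewrite [RHS]dotC.
  by rewrite phiv [LHS]hermC mul1r.
have [->|v0] := eqVneq v 0; first by rewrite normr0.
have {}v0 : 0 < `|v| by rewrite normr_gt0.
rewrite -(ler_pM2r v0) -expr2 inner_norm -phiv.
by apply: le_trans (phiM v); rewrite real_ler_norm// phiv -inner_norm ger0_real// exprn_ge0.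
Qed.

Let GT : set (I * I -> C) :=
  [set t | exists u v : H, t = ftens (l2val u) (l2val v)].

Lemma tensors_l2 : GT `<=` l2.
Proof. by move=> _ [u [v ->]]; apply: l2_ftens; exact: spanH_l2. Qed.

Let T : hilbertSpace R := spanH GT.

Lemma tensor_gen (u v : H) : GT (ftens (l2val u) (l2val v)).
Proof. by exists u, v. Qed.

Definition feature_tens (u v : H) : T :=
  mkspan (clspan_lspan (tensors_l2 (tensor_gen u v)) (lspan_gen (tensor_gen u v))).

Lemma feature_tens_bilinear : bilinear_for *:%R *:%R feature_tens.
Proof.
split=> [v k a b|u k a b]; apply: val_inj; apply/funext => p /=.
  by rewrite /ftens /= mulrDl -mulrA.
by rewrite /ftens /= mulrDr mulrCA.
Qed.

HB.instance Definition _ := bilinear_isBilinear.Build C H H T *:%R *:%R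
  feature_tens feature_tens_bilinear.

Lemma feature_tens_inner (u u' v v' : H) :
  inner T (feature_tens u v) (feature_tens u' v') = inner H u u' * inner H v v'.
Proof. by apply: dot_ftens; exact: spanH_l2. Qed.

Lemma lspan_tensors (t : T) : lspan GT (l2val t) ->
  exists s : seq (H * H), t = \sum_(p <- s) feature_tens p.1 p.2.
Proof.
move: t => [t tP] /= ts.
suff [s ts'] : exists s : seq (H * H), t = l2val (\sum_(p <- s) feature_tens p.1 p.2).
  by exists s; apply: val_inj.
elim: ts => [|k _ b [u [v ->]] _ [s ->]]; first by exists [::]; rewrite big_nil.
(* The scalar goes into the left factor, since [tens_dense] speaks of plain sums of simple
   tensors. *)
exists ((k *: u, v) :: s); rewrite big_cons /=.
apply/funext => p; rewrite -[RHS]/(ftens _ _ p + l2val _ p).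
by rewrite -[LHS]/(k * ftens _ _ p + l2val _ p) /ftens /= mulrA.
Qed.

Lemma feature_tens_dense : dense [set t : T |
  exists s : seq (H * H), t = \sum_(p <- s) feature_tens p.1 p.2].
Proof.
move=> O [t Ot] oO; have : nbhs t O by exact: open_nbhs_nbhs.
rewrite -nbhs_ballE => -[e /= e0 teO].
have [b sb tb] := spanH_approx tensors_l2 t e0; exists b; split.
  by apply: teO; rewrite -ball_normE.
exact: lspan_tensors.
Qed.

Definition feature_tensor : hilbertTensor featureRKHS featureRKHS :=
  @HilbertTensor R H H T feature_tens feature_tens_inner feature_tens_dense.

Variables (D : (I -> C) -> (I * I -> C)) (c : C).
Hypothesis D_lin : forall k a b, D (k *: a + b) = k *: D a + D b.
Hypothesis c0 : 0 <= c.
Hypothesis D_l2 : forall a M, l2le a M -> l2le (D a) (c ^+ 2 * M).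
Hypothesis D_Phi : forall x, D (Phi x) = ftens (Phi x) (Phi x).

Let D0 : D 0 = 0.
Proof.
have := D_lin (-1) 0 0; rewrite !scaleN1r oppr0 addr0 addNr.
by [].
Qed.

(** [D] sends a feature to a simple tensor, hence the span of the features into the span of the
    simple tensors; being bounded on all of l^2, it carries approximations along. *)
Let D_clspan a : clspan G a -> clspan GT (D a).
Proof.
move=> [la Ca]; split; first by have [M /D_l2] := la; exists (c ^+ 2 * M).
move=> e e0; have c1 : 0 < c ^+ 2 + 1 by rewrite ltr_wpDl// exprn_ge0.
have [b sb ab] := Ca (e / (c ^+ 2 + 1)) (divr_gt0 e0 c1).
exists (D b).
  elim: sb => [|k _ d [x _ <-] _ ih]; first by rewrite D0; exact: lspan0.
  rewrite D_lin; apply: lspan_cons => //; exists (feature x), (feature x).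
  exact: D_Phi.
have -> : D a - D b = D (a - b).
  rewrite (_ : a - b = (-1) *: b + a); last by rewrite scaleN1r addrC.
  by rewrite D_lin scaleN1r addrC.
move=> B; apply: le_trans (D_l2 ab B) _.
rewrite mulrCA -[leRHS]mulr1 ler_wpM2l ?(ltW e0)//.
by rewrite ler_pdivrMr// mul1r lerDl.
Qed.

Definition feature_comul (u : H) : T := mkspan (D_clspan (l2valP u)).

Lemma feature_comul_linear : linear feature_comul.
Proof. by move=> k u v; apply: val_inj; rewrite /= D_lin. Qed.

HB.instance Definition _ := GRing.isLinear.Build C H T *:%R
  feature_comul feature_comul_linear.

Lemma featureRKHS_rkha : is_rkha featureRKHS.
Proof.
exists feature_tensor, feature_comul; split.
  exists c => u; apply: norm_l2le; first by rewrite mulr_ge0.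
  by rewrite exprMn; apply: D_l2; exact: l2le_norm.
move=> x; rewrite feature_kernel_section; apply: val_inj; exact: D_Phi.
Qed.

End FeatureRKHS.

(** * Characters *)

Section Contraction.
Variables (R : realType) (V : completeNormedModType (Cplx R)).
Local Notation C := (Cplx R).
Variables (f : V -> V) (q : R).
Hypothesis q1 : q < 1.
Hypothesis fq : forall u v, `|f u - f v| <= ofR q * `|u - v|.

Let N (u : V) : R := reC `|u - f u|.

Let NE u : ofR (N u) = `|u - f u|.
Proof. by rewrite ofR_reC. Qed.

Let N_ge0 u : 0 <= N u.
Proof. exact: reC_ge0. Qed.

Let Nf u : N (f u) <= q * N u.
Proof. by rewrite -ofR_le ofRM !NE. Qed.

(* The fixed point is the limit of the Cauchy filter of almost fixed points; the
   Banach fixed point theorem of the library is only for real scalars. *)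
Lemma almost_fixed (e : R) : 0 < e -> exists u, N u < e.
Proof.
move=> e0; apply: contrapT => noe.
have Ne u : e <= N u by rewrite leNgt; apply/negP => ue; apply: noe; exists u.
have Ninf : has_inf (range N).
  by split; [exists (N 0), 0|exists 0 => _ [u _ <-]].
pose m := inf (range N).
have em : e <= m by apply: lb_le_inf; [exact: Ninf.1|move=> _ [u _ <-]].
have m0 : 0 < m := lt_le_trans e0 em.
(* The margin is chosen so that [q * (m + (1 - q) * m) = m - (1 - q) ^+ 2 * m], which lies below the
   infimum [m]. *)
have d0 : 0 < (1 - q) * m by rewrite mulr_gt0// subr_gt0.
have [_ [u _ <-] um] := inf_adherent d0 Ninf.
have mf : m <= N (f u) by apply: ge_inf; [exact: Ninf.2|exists (f u)].
have q0 : 0 <= q.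
  have : 0 <= q * N u := le_trans (N_ge0 _) (Nf u).
  by rewrite pmulr_lge0// (lt_le_trans e0).
have := le_trans mf (Nf u); rewrite -/m in um.
have : q * N u <= q * (m + (1 - q) * m) by rewrite ler_wpM2l// ltW.
have : 0 < (1 - q) ^+ 2 * m by rewrite mulr_gt0// exprn_gt0// subr_gt0.
by rewrite expr2; lra.
Qed.

Let approx : set_system V :=
  filter_from [set e : R | 0 < e] (fun e => [set u | N u < e]).

Let approx_filter : ProperFilter approx.
Proof.
apply: filter_from_proper.
  apply: filter_from_filter; first by exists 1 => /=.
  move=> e d /= e0 d0; exists (Num.min e d); first by rewrite /= lt_min e0.
  by move=> u /=; rewrite lt_min => /andP[].
by move=> e /= /almost_fixed.
Qed.
Existing Instance approx_filter.

(** [u - v] differs from [f u - f v] by the two displacements, and [f] shrinks the distance by [q].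
    This makes [approx] a Cauchy filter. *)
Let approx_dist u v : (1 - q) * reC `|u - v| <= N u + N v.
Proof.
rewrite -ofR_le ofRM ofRD !NE ofR_reC// ofRB mulrBl mul1r lerBlDr.
have {1}-> : u - v = (u - f u) + (f u - f v) - (v - f v) by rewrite opprB !subrKA.
apply: le_trans (ler_normB _ _) _.
apply: le_trans (lerD (ler_normD _ _) (lexx _)) _.
by rewrite addrAC lerD2l.
Qed.

Lemma contraction_fixpoint : exists u : V, f u = u.
Proof.
have q1' : 0 < 1 - q by rewrite subr_gt0.
have : cauchy approx.
  apply/cauchy_ballP => e /gt0_ofR[-> e0].
  pose d := (1 - q) * reC e / 2; have d0 : 0 < d by rewrite divr_gt0 ?mulr_gt0.
  pose A : set V := [set u | N u < d].
  have FA : approx A by exists d.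
  exists (A, A) => // -[u v] /= [Au Av]; rewrite -ball_normE /=.
  rewrite -(@ofR_reC _ `|u - v|)// ofR_lt -(ltr_pM2l q1').
  apply: le_lt_trans (approx_dist u v) _.
  by move: Au Av; rewrite /A /d /=; lra.
move=> /(@cauchy_cvg V)/cvg_ex[u Fu0].
have Fu : v @[v --> approx] --> u by exact: Fu0.
exists u; apply/eqP; rewrite eq_sym -subr_eq0 -normr_le0; apply/ler_addgt0Pr => e e0.
rewrite add0r; have e4 : 0 < e / 4 by rewrite divr_gt0.
have [e4E re4] := gt0_ofR e4.
near approx => v.
have uv : `|u - v| <= e / 4.
  by apply: ltW; near: v; apply: cvgr_dist_lt.
have vv : `|v - f v| <= e / 4.
  by rewrite -NE e4E ofR_le ltW//; near: v; exists (reC (e / 4)).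
have -> : u - f u = (u - v) + (v - f v) + (f v - f u).
  by rewrite !subrKA.
apply: le_trans (ler_normD _ _) _.
apply: le_trans (lerD (ler_normD _ _) (fq _ _)) _.
have qe : ofR q * `|v - u| <= e / 4.
  apply: le_trans (_ : 1 * `|v - u| <= _); last by rewrite mul1r distrC.
  by rewrite ler_wpM2r// (_ : 1 = ofR 1)// ofR_le ltW.
apply: le_trans (lerD (lerD uv vv) qe) _.
rewrite -[leRHS]twice_quarters mulr_natl mulr2n -!addrA lerD2l lerD2l.
by rewrite lerDl ltW.
Unshelve. all: by end_near. Qed.

End Contraction.

Section EvalLinear.
Variables (R : realType) (X : Type) (H : rkhs R X).
Local Notation C := (Cplx R).

Lemma evalfD (f h : H) x : evalf H (f + h) x = evalf H f x + evalf H h x.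
Proof. by rewrite linearD. Qed.

Lemma evalfB (f h : H) x : evalf H (f - h) x = evalf H f x - evalf H h x.
Proof. by rewrite linearB. Qed.

Lemma evalfZ (k : C) (f : H) x : evalf H (k *: f) x = k * evalf H f x.
Proof. by rewrite linearZ. Qed.

Lemma evalf0 x : evalf H 0 x = 0.
Proof. by rewrite linear0. Qed.

Lemma evalf_sum (I : Type) (r : seq I) (F : I -> H) x :
  evalf H (\sum_(i <- r) F i) x = \sum_(i <- r) evalf H (F i) x.
Proof.
elim: r => [|i r ih]; first by rewrite !big_nil evalf0.
by rewrite !big_cons evalfD ih.
Qed.

End EvalLinear.

Section RKHAlgebra.
Variables (R : realType) (X : Type) (H : rkhs R X).
Local Notation C := (Cplx R).
Hypothesis reproducing : forall (f : H) x,
  evalf H f x = inner H f (kernel_section H x).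

(** Multiplication is the adjoint of [Delta]: the product is the Riesz representer of
    [u |-> <Delta u, f (x) g>], a functional that at a kernel section factors, up to conjugation,
    into the two evaluations. *)
Lemma rkha_mul : is_rkha H -> exists2 M : C, 0 <= M & forall f g : H,
  exists2 h : H, (forall x, evalf H h x = evalf H f x * evalf H g x) &
    `|h| <= M * `|f| * `|g|.
Proof.
(* [bounded_operator] leaves the sign of its constant open. *)
move=> [T [Delta [[M DM] Dk]]]; exists `|M| => // f g.
have tensE : `|tens T f g| = `|f| * `|g|.
  apply/eqP; rewrite -(@eqrXn2 _ 2)// ?mulr_ge0//.
  by rewrite exprMn !inner_norm tens_inner.
have DM' u : `|Delta u| <= `|M| * `|u|.
  have MM : `|M * `|u| | = M * `|u| by rewrite ger0_norm// (le_trans _ (DM u)).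
  by apply: le_trans (DM u) _; rewrite -MM normrM normr_id.
pose phi (u : H) : C := inner T (Delta u) (tens T f g).
have phil : scalar phi by move=> k u v; rewrite /phi linearP linearPl.
have phiM u : `|phi u| <= (`|M| * `|f| * `|g|) * `|u|.
  apply: le_trans (hilbert_CauchySchwarz _ _) _; rewrite tensE.
  rewrite (_ : _ * `|u| = (`|M| * `|u|) * (`|f| * `|g|)); last by ring.
  by rewrite ler_wpM2r// mulr_ge0.
have M0 : 0 <= `|M| * `|f| * `|g| by rewrite !mulr_ge0.
have [h phih] := riesz_representation phil M0 phiM.
exists h => [x|].
  rewrite !reproducing; set k := kernel_section H x.
  have -> : inner H h k = (phi k)^* by rewrite phih [LHS]hermC mul1r.
  rewrite /phi Dk tens_inner rmorphM /=.
  by congr (_ * _); rewrite [RHS]hermC mul1r.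
have [->|h0] := eqVneq h 0; first by rewrite normr0.
have {}h0 : 0 < `|h| by rewrite normr_gt0.
rewrite -(ler_pM2r h0) -expr2 inner_norm -phih.
by apply: le_trans (phiM h); rewrite real_ler_norm// phih -inner_norm ger0_real// exprn_ge0.
Qed.

Lemma char_mul (chi : H -> C) (f g h : H) : spectrum H chi ->
  (forall x, evalf H h x = evalf H f x * evalf H g x) -> chi h = chi f * chi g.
Proof. by move=> [_ _]; apply. Qed.

Lemma char_unit (chi : H -> C) (e : H) : spectrum H chi ->
  (forall x, evalf H e x = 1) -> chi e = 1.
Proof.
move=> chiH e1; have [_ [f f0] _] := chiH; apply: (mulIf f0); rewrite mul1r.
by rewrite -(char_mul (f := e) (g := f) (h := f) chiH)// => x; rewrite e1 mul1r.
Qed.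

Lemma char_scalar (chi : H -> C) : spectrum H chi -> scalar chi.
Proof. by case. Qed.

Lemma char0 (chi : H -> C) : spectrum H chi -> chi 0 = 0.
Proof.
move=> /char_scalar chil.
by have := chil (-1) 0 0; rewrite scaler0 addr0 mulN1r addNr.
Qed.

Lemma charZ (chi : H -> C) k f : spectrum H chi -> chi (k *: f) = k * chi f.
Proof. by move=> chiH; rewrite -[k *: f]addr0 char_scalar// char0// addr0. Qed.

Lemma charD (chi : H -> C) f g : spectrum H chi -> chi (f + g) = chi f + chi g.
Proof. by move=> chiH; rewrite -{1}[f]scale1r char_scalar// mul1r. Qed.

Lemma charB (chi : H -> C) f g : spectrum H chi -> chi (f - g) = chi f - chi g.
Proof. by move=> chiH; rewrite charD// -scaleN1r charZ// mulN1r. Qed.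

Lemma char_sum (chi : H -> C) (I : Type) (r : seq I) (F : I -> H) :
  spectrum H chi -> chi (\sum_(i <- r) F i) = \sum_(i <- r) chi (F i).
Proof.
move=> chiH; elim: r => [|i r ih]; first by rewrite !big_nil char0.
by rewrite !big_cons charD// ih.
Qed.

(* If [M * |f| < |chi f|], rescale [f] to [u] with [chi u = 1]; then
   [g = e + u g] has a solution, and [chi g = 1 + chi g]. *)
Lemma char_norm (chi : H -> C) (e : H) (M : C) : spectrum H chi ->
  (forall x, evalf H e x = 1) -> 0 <= M ->
  (forall f g : H, exists2 h : H,
     (forall x, evalf H h x = evalf H f x * evalf H g x) &
     `|h| <= M * `|f| * `|g|) ->
  forall f, `|chi f| <= M * `|f|.
Proof.
move=> chiH e1 M0 mulM f; rewrite real_leNgt ?normr_real ?realM ?ger0_real//.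
apply/negP => Mf; have chil := char_scalar chiH.
have chif : chi f != 0 by rewrite -normr_gt0 (le_lt_trans _ Mf)// mulr_ge0.
pose u := (chi f)^-1 *: f.
have chiu : chi u = 1 by rewrite charZ// mulVf.
have Mu : M * `|u| < 1.
  by rewrite normrZ normfV mulrCA ltr_pdivrMl ?mulr1// normr_gt0.
have [p pP] := choice (fun g => let: ex_intro2 h h1 h2 := mulM u g in
  ex_intro (fun h => (forall x, evalf H h x = evalf H u x * evalf H g x) /\
     `|h| <= M * `|u| * `|g|) h (conj h1 h2)).
have pB g g' : p g - p g' = p (g - g').
  apply: (@evalf_inj _ _ H); apply/funext => x.
  by rewrite evalfB !(pP _).1 evalfB mulrBr.
have qE : ofR (reC (M * `|u|)) = M * `|u| by rewrite ofR_reC// ger0_real// mulr_ge0.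
have [||g ge] := @contraction_fixpoint R H (fun g => e + p g) (reC (M * `|u|)).
- by rewrite -ofR_lt qE (_ : ofR 1 = 1).
- by move=> g g'; rewrite qE opprD addrACA subrr add0r pB; exact: (pP _).2.
have : chi g = 1 + chi g.
  rewrite -{1}ge -[e]scale1r chil (char_unit chiH e1) mulr1.
  by rewrite (char_mul chiH (pP g).1) chiu mul1r.
by move/eqP; rewrite -subr_eq0 opprD addrCA subrr addr0 oppr_eq0 oner_eq0.
Qed.

End RKHAlgebra.

(** * The word algebra *)

Section Weights.
Variable K : numFieldType.

(** The shift by two makes the squares sum to at most 1, by comparison with the telescoping series
    of [1 / ((m + 1) (m + 2))]. *)
Definition wt (m : nat) : K := (m.+2)%:R^-1.

Lemma wt_gt0 m : 0 < wt m.
Proof. by rewrite invr_gt0 ltr0n. Qed.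

Lemma sum_wt2 N : \sum_(k < N) wt k ^+ 2 <= 1 - N.+1%:R^-1.
Proof.
elim: N => [|N ih]; first by rewrite big_ord0 invr1 subrr.
rewrite big_ord_recr /=; apply: le_trans (lerD ih (lexx _)) _.
rewrite -addrA lerD2l -lerBrDl opprK addrC -subr_ge0 /wt.
have n1 : N.+1%:R != 0 :> K by rewrite pnatr_eq0.
have n2 : N.+2%:R != 0 :> K by rewrite pnatr_eq0.
have -> : N.+1%:R^-1 - N.+2%:R^-1 - N.+2%:R^-1 ^+ 2 = (N.+2%:R ^+ 2 * N.+1%:R)^-1 :> K.
  have e2 : N.+2%:R = N.+1%:R + 1 :> K by rewrite -[in LHS]addn1 natrD.
  move: n1 n2; rewrite e2; move: (N.+1%:R : K) => x n1 n2.
  by field; rewrite n1 n2.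
by rewrite invr_ge0 mulr_ge0// exprn_ge0.
Qed.

Lemma sum_wt2_le1 N : \sum_(k < N) wt k ^+ 2 <= 1.
Proof.
by apply: le_trans (sum_wt2 N) _; rewrite lerBlDr lerDl invr_ge0.
Qed.

Lemma sum_uniq_le (s : seq nat) (f : nat -> K) N : (forall k, 0 <= f k) ->
  uniq s -> \sum_(k <- s) (if (k < N)%N then f k else 0) <= \sum_(k < N) f k.
Proof.
move=> f0 us; rewrite -big_mkcond -big_filter.
have us' : uniq [seq k <- s | (k < N)%N] by rewrite filter_uniq.
rewrite (perm_big [seq k <- iota 0 N | k \in s]) /=; last first.
  apply: uniq_perm => //; first by rewrite filter_uniq ?iota_uniq.
  by move=> k; rewrite !mem_filter mem_iota add0n andbC.
rewrite big_filter big_mkcond -(big_mkord xpredT f) /index_iota subn0.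
by apply: ler_sum => k _; case: ifP.
Qed.

Lemma sum_wt2_seq (s : seq nat) : uniq s -> \sum_(k <- s) wt k ^+ 2 <= 1.
Proof.
move=> us; pose N := (\max_(k <- s) k).+1.
apply: le_trans (sum_wt2_le1 N).
apply: le_trans (@sum_uniq_le s (fun k => wt k ^+ 2) N _ us).
  rewrite big_seq [leRHS]big_seq; apply: ler_sum => k ks.
  by rewrite (_ : (k < N)%N)// ltnS; exact: leq_bigmax_seq.
by move=> k; rewrite exprn_ge0// ltW// wt_gt0.
Qed.

(** Since [(k + 2) + (l + 2) = (k + l + 2) + 2], the left side equals
    [wt k + wt l - 2 * wt k * wt l]. *)
Lemma wt_split k l : wt k * wt l / wt (k + l) <= wt k + wt l.
Proof.
rewrite -subr_ge0 /wt invrK.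
have k0 : k.+2%:R != 0 :> K by rewrite pnatr_eq0.
have l0 : l.+2%:R != 0 :> K by rewrite pnatr_eq0.
have e : (k + l).+2%:R = k.+2%:R + l.+2%:R - 2 :> K.
  by rewrite -!natrD -natrB// !addSn !addnS !subSS subn0.
have -> : k.+2%:R^-1 + l.+2%:R^-1 - k.+2%:R^-1 / l.+2%:R * (k + l).+2%:R =
    2 / (k.+2%:R * l.+2%:R) :> K.
  move: k0 l0; rewrite e; move: (k.+2%:R : K) (l.+2%:R : K) => x y k0 l0.
  by field; rewrite k0 l0.
by rewrite divr_ge0// mulr_ge0.
Qed.

(* The constant in [k^2 <= 4 k]: a word of length [n] splits at each [k <= n]. *)
Lemma sum_wt_split n (s : seq nat) : uniq s ->
  \sum_(k <- s) (if (k <= n)%N then (wt k * wt (n - k) / wt n) ^+ 2 else 0) <= 2 ^+ 2.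
Proof.
move=> us.
have wt0 := wt_gt0.
(* From [(x + y)^2 <= 2 (x^2 + y^2)]; each of the two squares sums to at most 1 over the cuts, the
   second after reversing their order, whence the total 4. *)
pose f k := 2 * (wt k ^+ 2 + wt (n - k) ^+ 2).
have le_f : \sum_(k <- s) (if (k <= n)%N then (wt k * wt (n - k) / wt n) ^+ 2 else 0) <=
    \sum_(k <- s) (if (k < n.+1)%N then f k else 0).
  apply: ler_sum => k _; rewrite ltnS; case: ifP => // kn.
  have {1}-> : n = (k + (n - k))%N by rewrite subnKC.
  have h := wt_split k (n - k).
  have {h} : (wt k * wt (n - k) / wt (k + (n - k))) ^+ 2 <= (wt k + wt (n - k)) ^+ 2.
    by rewrite lerXn2r// nnegrE ?addr_ge0 ?divr_ge0 ?mulr_ge0 ?ltW.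
  rewrite subnKC// => h; apply: le_trans h _; rewrite -subr_ge0.
  rewrite (_ : _ - _ = (wt k - wt (n - k)) ^+ 2); last by rewrite /f; ring.
  by rewrite real_exprn_even_ge0// rpredB// ger0_real// ltW.
apply: le_trans le_f _; apply: le_trans (sum_uniq_le _ _ us) _.
  by move=> k; rewrite mulr_ge0// addr_ge0// exprn_ge0// ltW.
rewrite -mulr_sumr expr2 ler_wpM2l// big_split /= (_ : 2 = 1 + 1)//.
apply: lerD; first exact: sum_wt2_le1.
rewrite (reindex_inj rev_ord_inj) /=.
rewrite (eq_bigr (fun k : 'I_n.+1 => wt k ^+ 2)); first exact: sum_wt2_le1.
by move=> k _; rewrite subSS subKn// -ltnS.
Qed.

End Weights.

Section WordSums.
Variables (K : numFieldType) (A : choiceType) (p : A -> K).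
Hypothesis p0 : forall j, 0 <= p j.
Hypothesis p1 : forall s : seq A, uniq s -> \sum_(j <- s) p j <= 1.

Let W (m : nat) (w : seq A) : K := if size w == m then \prod_(j <- w) p j else 0.

Let W_ge0 m w : 0 <= W m w.
Proof. by rewrite /W; case: ifP => // _; exact: prodr_ge0. Qed.

(** Over all words of length [m] the products expand the [m]-th power of the sum of [p]; the
    induction takes off the first letter. *)
Lemma sum_words_size (m : nat) (B : {fset seq A}) : \sum_(w <- B) W m w <= 1.
Proof.
elim: m B => [|m ih] B.
  apply: le_trans (@ler_sum_fsubset K _ (W 0) B ([fset [::]] `|` B)%fset _ _) _ => //.
    exact: fsubsetUr.
  rewrite (big_fsetD1 [::]) ?inE//= /W /= big_nil big_seq big1 ?addr0// => w.
  by rewrite !inE => /andP[w0 _]; rewrite size_eq0 (negPf w0).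
(* The first letter is an option because of the empty word, which does not have length [m.+1] and
   contributes zero. *)
pose F (o : option A) v : K := if o is Some j then p j * W m v else 0.
pose c (o : option A) : K := if o is Some j then p j else 0.
pose h (w : seq A) := (ohead w, behead w).
have hinj : injective h by move=> [|a v] [|b u] //= [-> ->].
have -> : \sum_(w <- B) W m.+1 w = \sum_(y <- [fset h w | w in B]%fset) F y.1 y.2.
  rewrite [RHS]big_imfset /=; last by move=> ? ? _ _; exact: hinj.
  apply: eq_bigr => -[|a v] _ //=; rewrite /W /= eqSS.
  by case: ifP => _; rewrite ?big_cons ?mulr0.
apply: le_trans (@ler_sum_fst K _ _ _ F c _ _) _.
- by move=> [j|] v //=; rewrite mulr_ge0.
- move=> [j|] J0 /=; last by rewrite big1.
  by rewrite -mulr_sumr -[leRHS]mulr1 ler_wpM2l.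
set O := [fset _ | _ in _]%fset.
have -> : \sum_(o <- O) c o = \sum_(j <- pmap id O) p j.
  elim: (enum_fset O) => [|[j|] s ihs] /=; rewrite ?big_nil// !big_cons ihs//.
  by rewrite add0r.
by apply: p1; apply: (pmap_uniq (g := Some)); [case|exact: fset_uniq].
Qed.

(** For [p j = |g j x| ^+ 2] this is the bound k(x, x) <= 1. *)
Lemma sum_words (B : {fset seq A}) :
  \sum_(w <- B) wt K (size w) ^+ 2 * \prod_(j <- w) p j <= 1.
Proof.
pose h (w : seq A) := (size w, w).
have hinj : injective h by move=> w v [].
have -> : \sum_(w <- B) wt K (size w) ^+ 2 * \prod_(j <- w) p j =
    \sum_(y <- [fset h w | w in B]%fset) wt K y.1 ^+ 2 * W y.1 y.2.
  rewrite [RHS]big_imfset /=; last by move=> ? ? _ _; exact: hinj.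
  by apply: eq_bigr => w _; rewrite /W eqxx.
apply: le_trans (@ler_sum_fst K _ _ _ (fun m w => wt K m ^+ 2 * W m w)
  (fun m => wt K m ^+ 2) _ _) _.
- by move=> m w; rewrite mulr_ge0// exprn_ge0// ltW// wt_gt0.
- move=> m J0; rewrite -mulr_sumr -[leRHS]mulr1 ler_wpM2l ?sum_words_size//.
  by rewrite exprn_ge0// ltW// wt_gt0.
- exact/sum_wt2_seq/fset_uniq.
Qed.

End WordSums.

Section WordAlgebra.
Variables (R : realType) (X : topologicalType) (A : choiceType).
Local Notation C := (Cplx R).
Local Notation wt := (wt C).
Variable g : A -> X -> C.
Hypothesis g1 : forall x (s : seq A), uniq s -> \sum_(j <- s) `|g j x| ^+ 2 <= 1.

Let mon (w : seq A) (x : X) : C := \prod_(j <- w) g j x.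

(** The conjugate compensates for the conjugate-linear second argument of the inner product:
    evaluation then yields series in the products of the [g j] themselves. *)
Definition word_feature (x : X) (w : seq A) : C := wt (size w) * (mon w x)^*.

Lemma word_feature_l2le x : l2le (word_feature x) 1.
Proof.
move=> B; apply: le_trans (sum_words (fun j => exprn_ge0 2 (normr_ge0 (g j x))) (g1 x) B).
apply: ler_sum => w _; rewrite normrM norm_conjC exprMn.
rewrite (ger0_norm (ltW (wt_gt0 _ _))) ler_wpM2l ?exprn_ge0 ?(ltW (wt_gt0 _ _))//.
by rewrite /mon normr_prod prodrXl.
Qed.

Lemma word_feature_l2 x : l2 (word_feature x).
Proof. by exists 1; exact: word_feature_l2le. Qed.

Definition wordRKHS : rkhs R X := featureRKHS word_feature_l2.

(* The coefficient is the one for which [word_comul] sends the feature of [x] to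
   its tensor square. *)
Definition word_comul (a : seq A -> C) (p : seq A * seq A) : C :=
  wt (size p.1) * wt (size p.2) / wt (size p.1 + size p.2) * a (p.1 ++ p.2).

Lemma word_comul_l2le a M : l2le a M -> l2le (word_comul a) (2 ^+ 2 * M).
Proof.
(* A pair of words amounts to its concatenation and the place of the cut; grouping by the
   concatenation leaves [sum_wt_split] for each word. *)
move=> aM B; pose h (p : seq A * seq A) := (p.1 ++ p.2, size p.1).
have hinj : injective h.
  move=> [u v] [u' v'] [/= /eqP uv su]; move: uv.
  by rewrite eqseq_cat// => /andP[/eqP -> /eqP ->].
pose F (w : seq A) k : C := if (k <= size w)%N then
  (wt k * wt (size w - k) / wt (size w)) ^+ 2 * `|a w| ^+ 2 else 0.
have -> : \sum_(p <- B) `|word_comul a p| ^+ 2 =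
    \sum_(y <- [fset h p | p in B]%fset) F y.1 y.2.
  rewrite [RHS]big_imfset /=; last by move=> ? ? _ _; exact: hinj.
  apply: eq_bigr => -[u v] _; rewrite /F /= size_cat leq_addr addKn.
  rewrite normrM exprMn ger0_norm// divr_ge0 ?mulr_ge0// ltW// wt_gt0//.
apply: le_trans (@ler_sum_fst C _ _ _ F (fun w => 2 ^+ 2 * `|a w| ^+ 2) _ _) _.
- move=> w k; rewrite /F; case: ifP => // _; rewrite mulr_ge0 ?exprn_ge0//.
  by rewrite divr_ge0 ?mulr_ge0// ltW// wt_gt0.
- move=> w J0; have := sum_wt_split C (size w) (fset_uniq J0).
  move=> /(ler_wpM2r (exprn_ge0 2 (normr_ge0 (a w)))); apply: le_trans.
  rewrite mulr_suml; apply: ler_sum => k _; rewrite /F.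
  by case: ifP => _; rewrite ?mul0r.
- by rewrite -mulr_sumr ler_wpM2l// exprn_ge0.
Qed.

Lemma wordRKHS_rkha : is_rkha wordRKHS.
Proof.
apply: (@featureRKHS_rkha _ _ _ _ _ word_comul 2) => //.
- move=> k a b; apply/funext => p; rewrite /word_comul.
  by rewrite -[LHS]/(_ * (k * a _ + b _)) mulrDr mulrCA.
- exact: word_comul_l2le.
- move=> x; apply/funext => -[u v]; rewrite /word_comul /ftens /word_feature /=.
  rewrite size_cat /mon big_cat /= rmorphM /= mulrA divfK ?gt_eqF ?wt_gt0//.
  by rewrite mulrACA.
Qed.

Lemma word_reproducing (f : wordRKHS) x :
  evalf wordRKHS f x = inner wordRKHS f (kernel_section wordRKHS x).
Proof. by rewrite feature_kernel_section. Qed.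

Lemma word_eval_norm (f : wordRKHS) x : `|evalf wordRKHS f x| <= `|f|.
Proof.
rewrite word_reproducing feature_kernel_section.
apply: le_trans (hilbert_CauchySchwarz _ _) _.
rewrite -[leRHS]mulr1 ler_wpM2l//; apply: norm_l2le => //.
by rewrite expr1n; exact: word_feature_l2le.
Qed.

(** The unit vector at [w] names [wt (size w)] times the product of the letters; rescaling it costs
    the inverse of the weight. *)
Lemma word_monomial (w : seq A) : exists2 f : wordRKHS,
  (forall x, evalf wordRKHS f x = \prod_(j <- w) g j x) & `|f| <= (wt (size w))^-1.
Proof.
have wt0 := wt_gt0 C (size w); have wt0' : wt (size w) != 0 by rewrite gt_eqF.
have ld : l2 (delta R w) by exists 1; exact: l2le_delta.
have lw : l2 ((wt (size w))^-1 *: (delta R w)).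
  by rewrite -[_ *: _]addr0; apply: l2_lin => //; exact: l2_0.
have [f [fE fn]] := feature_represent word_feature_l2 lw; exists f.
  move=> x; rewrite fE -[_ *: _]addr0 dot_linl//; first last.
  - exact: word_feature_l2.
  - exact: l2_0.
  rewrite dot_delta; last exact: word_feature_l2.
  rewrite (dotC l2_0 (word_feature_l2 x)) dot0r conjC0 addr0 /word_feature.
  rewrite rmorphM /= conjCK (geC0_conj (ltW wt0)) mulrA mulVf// mul1r //.
apply: le_trans fn _.
rewrite -(@ler_pXn2r _ 2)// ?nnegrE ?invr_ge0 ?sqrtC_ge0; first last.
- exact: ltW.
- exact: l2le_ge0 (l2le_dot lw).
rewrite sqrtCK; apply: dot_le => B; apply: le_trans (l2leZ _ (@l2le_delta R _ w) B) _.
by rewrite mulr1 ger0_norm// invr_ge0 ltW.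
Qed.

Lemma word_monomials : exists W : seq A -> wordRKHS,
  forall w x, evalf wordRKHS (W w) x = \prod_(j <- w) g j x.
Proof.
have [W WP] := choice (fun w => let: ex_intro2 f fE fn := word_monomial w in
  ex_intro (fun f => forall x, evalf wordRKHS f x = \prod_(j <- w) g j x) f fE).
by exists W.
Qed.

(** Monomials span a dense subspace: the coordinates of [f] on a finite set give the combination,
    and the remainder is the function named by the tail, of norm at most that of the tail. *)
Lemma word_approx (W : seq A -> wordRKHS) (f : wordRKHS) (e : C) :
  (forall w x, evalf wordRKHS (W w) x = \prod_(j <- w) g j x) -> 0 < e ->
  exists s : seq (C * seq A), `|f - \sum_(p <- s) p.1 *: W p.2| <= e.
Proof.
move=> WE e0; pose a := l2val f; have la : l2 a := spanH_l2 f.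
have [B Be] := l2le_tail la (exprn_gt0 2 e0).
set t := (fun w => _) in Be; have lt : l2 t by exists (e ^+ 2).
have [v [vE vn]] := feature_represent word_feature_l2 lt.
exists [seq (a w * wt (size w), w) | w <- B].
rewrite (_ : f - _ = v); last first.
  apply/eqP; rewrite subr_eq addrC; apply/eqP.
  apply: (@evalf_inj _ _ wordRKHS); apply/funext => x.
  rewrite big_map evalfD evalf_sum vE.
  have -> : evalf wordRKHS f x = dot a (word_feature x) by [].
  have {1}-> : a = 1 *: (a - t) + t by rewrite scale1r subrK.
  have lat : l2 (a - t) by exact: l2B.
  rewrite dot_linl ?mul1r//; last exact: word_feature_l2.
  congr (_ + _); rewrite (@dot_finsupp _ _ B)//; first last.
  - by move=> w wB; rewrite -[LHS]/(a w - t w) /t (negPf wB) subrr.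
  - exact: word_feature_l2.
  rewrite big_seq [RHS]big_seq; apply: eq_bigr => w wB.
  rewrite evalfZ WE /= -[(a - t) w]/(a w - t w) /t wB subr0.
  by rewrite /word_feature rmorphM /= conjCK (geC0_conj (ltW (wt_gt0 _ _))) mulrA.
apply: le_trans vn _; rewrite -(@ler_pXn2r _ 2)// ?nnegrE ?(ltW e0)//; last first.
  by rewrite sqrtC_ge0; exact: l2le_ge0 (l2le_dot lt).
by rewrite sqrtCK; exact: dot_le.
Qed.

Lemma word_char_bound : exists2 M : C, 0 <= M &
  forall chi, spectrum wordRKHS chi -> forall f : wordRKHS, `|chi f| <= M * `|f|.
Proof.
have [M M0 mulM] := rkha_mul word_reproducing wordRKHS_rkha.
have [e eE _] := word_monomial [::]; exists M => // chi chiH f.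
by apply: (char_norm (e := e) chiH _ M0 mulM) => x; rewrite eE big_nil.
Qed.

(** Multiplicativity forces [chi] on monomials, their span is dense, and [chi] and the evaluation
    are bounded, by [M] and by 1. *)
Lemma word_char_eval chi x : spectrum wordRKHS chi ->
  (forall j (f : wordRKHS), (forall y, evalf wordRKHS f y = g j y) -> chi f = g j x) ->
  forall f : wordRKHS, chi f = evalf wordRKHS f x.
Proof.
move=> chiH chig f; have [M M0 chiM] := word_char_bound.
have [W WE] := word_monomials.
have chiW w : chi (W w) = \prod_(j <- w) g j x.
  elim: w => [|j w ih].
    by rewrite big_nil (char_unit chiH)// => y; rewrite WE big_nil.
  rewrite big_cons -ih -(chig j (W [:: j])).
    by apply: (char_mul chiH) => y; rewrite !WE big_cons big_seq1.
  by move=> y; rewrite WE big_seq1.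
apply/eqP; rewrite -subr_eq0 -normr_le0; apply/ler_addgt0Pr => e e0; rewrite add0r.
have M1 : 0 < M + 1 by rewrite ltr_wpDl.
have [s fs] := word_approx f WE (divr_gt0 e0 M1).
set v := \sum_(p <- s) _ in fs.
have chiv : chi v = evalf wordRKHS v x.
  rewrite /v char_sum// evalf_sum; apply: eq_bigr => p _.
  by rewrite charZ// evalfZ chiW WE.
have chiB : chi f = chi (f - v) + chi v by rewrite -charD// subrK.
have evB : evalf wordRKHS f x = evalf wordRKHS (f - v) x + evalf wordRKHS v x.
  by rewrite -evalfD subrK.
rewrite chiB evB chiv opprD addrACA subrr addr0.
apply: le_trans (ler_normB _ _) _.
apply: le_trans (lerD (chiM _ chiH _) (word_eval_norm _ _)) _.
rewrite -[X in _ + X]mul1r -mulrDl -[leRHS](divfK (lt0r_neq0 M1)) mulrC.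
by rewrite ler_wpM2r// ltW.
Qed.

Lemma word_eval_continuous : (forall j, continuous (g j)) ->
  forall f : wordRKHS, continuous (evalf wordRKHS f : X -> C).
Proof.
move=> gc f x; apply/cvgrPdist_le => e e0.
have [W WE] := word_monomials.
have e3 : 0 < e / 3 by rewrite divr_gt0.
have [s fs] := word_approx f WE e3.
set v := \sum_(p <- s) _ in fs.
have vc : evalf wordRKHS v y @[y --> x] --> evalf wordRKHS v x.
  apply: cvg_ext (_ : \sum_(p <- s) p.1 * \prod_(j <- p.2) g j y @[y --> x] --> _).
    by move=> y; rewrite evalf_sum; apply: eq_bigr => p _; rewrite evalfZ WE.
  rewrite evalf_sum; under eq_bigr do rewrite evalfZ WE.
  apply: cvg_sum_seq => p; apply: cvgM; first exact: cvg_cst.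
  by apply: cvg_big => [|j _]; [exact: mul_continuous|exact: gc].
have fv y : `|evalf wordRKHS f y - evalf wordRKHS v y| <= e / 3.
  rewrite -evalfB.
  exact: le_trans (word_eval_norm _ _) fs.
near=> y.
have vxy : `|evalf wordRKHS v x - evalf wordRKHS v y| <= e / 3.
  by apply: ltW; near: y; exact: cvgr_dist_lt.
rewrite [leRHS]thirdsE -(subrKA (evalf wordRKHS v y) (evalf wordRKHS f x)).
rewrite -(subrKA (evalf wordRKHS v x) (evalf wordRKHS f x) (- evalf wordRKHS v y)).
apply: le_trans (ler_normD _ _) _; apply: lerD; last by rewrite distrC.
by apply: le_trans (ler_normD _ _) _; exact: lerD.
Unshelve. all: by end_near. Qed.

End WordAlgebra.

(** Bernoulli's inequality gives only linear growth, which the hypothesis permits; squaring it gives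
    quadratic growth, against a bound that stays linear at twice the exponent. *)
Lemma polynomially_bounded_powers (R : realType) (t K : R) : 0 <= t ->
  (forall m, t ^+ m.+1 <= K * m.+2%:R) -> t <= 1.
Proof.
move=> t0 tK; rewrite leNgt; apply/negP => t1.
pose h := t - 1; have h0 : 0 < h by rewrite subr_gt0.
have bern n : 1 + n%:R * h <= t ^+ n.
  elim: n => [|n ih]; first by rewrite mul0r addr0 expr0.
  rewrite exprS; apply: le_trans (ler_wpM2l t0 ih).
  have -> : t = 1 + h by rewrite /h addrC subrK.
  rewrite -natr1 -subr_ge0 (_ : _ - _ = n%:R * h ^+ 2); last by ring.
  by rewrite mulr_ge0// sqr_ge0.
have key n : n.+1%:R * h ^+ 2 <= 3 * K.
  have n0 : 0 < n.+1%:R :> R by rewrite ltr0n.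
  have K0 : 0 <= K.
    have := le_trans (exprn_ge0 1 t0) (tK 0%N); rewrite pmulr_lge0//.
  (* The exponent [2 (n + 1)] is [(2 n + 1) + 1], so the hypothesis gives [K * (2 n + 3)], which is
     at most [K * (3 (n + 1))]. *)
  have tn : (t ^+ n.+1) ^+ 2 <= K * (3 * n.+1%:R).
    rewrite -exprM (_ : (n.+1 * 2)%N = (2 * n).+2); last by rewrite mulnC mulnS.
    apply: le_trans (tK _) _; rewrite ler_wpM2l// -natrM ler_nat.
    by rewrite mulnS -addn3 addnC leq_add2l leq_mul2r orbT.
  have nh : (n.+1%:R * h) ^+ 2 <= (t ^+ n.+1) ^+ 2.
    rewrite lerXn2r// ?nnegrE ?exprn_ge0// ?mulr_ge0// ?(ltW h0)//.
    by apply: le_trans (bern _); rewrite lerDr.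
  have := le_trans nh tn; rewrite -(ler_pM2l n0 (n.+1%:R * h ^+ 2)).
  rewrite (_ : (n.+1%:R * h) ^+ 2 = n.+1%:R * (n.+1%:R * h ^+ 2)); last by ring.
  by move=> /le_trans; apply; rewrite [leRHS]mulrC mulrCA mulrA.
have h20 : 0 < h ^+ 2 by rewrite exprn_gt0.
pose n := Num.bound `|3 * K / h ^+ 2|.
have : 3 * K / h ^+ 2 < n.+1%:R.
  have nK : `|3 * K / h ^+ 2| < n%:R by apply: archi_boundP.
  by apply: le_lt_trans (ler_norm _) (lt_trans nK _); rewrite ltr_nat.
by rewrite ltr_pdivrMr// ltNge key.
Qed.

(** * The algebra generated by the powers of a countable family *)

Section PowerGenerators.
Variables (R : realType) (X : topologicalType) (G : countType).
Local Notation C := (Cplx R).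
Local Notation wt := (wt C).
Variable b : G -> X -> C.
Hypothesis b1 : forall k x, `|b k x| <= 1.

(** [choice.pickle] numbers the family injectively, so the sum of squares is bounded by a product of
    two sums of squared weights, each at most 1. The exponent starts at one; the constants come from
    the empty word. *)
Let gen (j : G * nat) (x : X) : C :=
  wt (choice.pickle j.1) * wt j.2 * b j.1 x ^+ j.2.+1.

Lemma sum_power_generators x (s : seq (G * nat)) : uniq s ->
  \sum_(j <- s) `|gen j x| ^+ 2 <= 1.
Proof.
move=> us; have wt_ge0 m : 0 <= wt m by rewrite ltW// wt_gt0.
pose F (k : G) (m : nat) : C := wt (choice.pickle k) ^+ 2 * wt m ^+ 2.
apply: (@le_trans _ _ (\sum_(j <- s) F j.1 j.2)).
  apply: ler_sum => -[k m] _; rewrite /gen /F /= -exprMn lerXn2r// ?nnegrE ?mulr_ge0//.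
  rewrite normrM ger0_norm ?mulr_ge0// -[leRHS]mulr1 ler_wpM2l ?mulr_ge0//.
  by rewrite normrX exprn_ile1.
rewrite (perm_big [fset j | j in s]%fset) /=; last first.
  by apply: uniq_perm => // j; rewrite !inE.
apply: le_trans (@ler_sum_fst C _ _ _ F (fun k => wt (choice.pickle k) ^+ 2) _ _) _.
- by move=> k m; rewrite mulr_ge0// exprn_ge0.
- move=> k J0; rewrite -mulr_sumr -[leRHS]mulr1 ler_wpM2l ?exprn_ge0//.
  exact/sum_wt2_seq/fset_uniq.
- rewrite -(big_map (fun k : G => choice.pickle k) xpredT (fun m => wt m ^+ 2)).
  by apply: sum_wt2_seq; rewrite map_inj_uniq ?fset_uniq//; exact: (pcan_inj choice.pickleK).
Qed.

Let H : rkhs R X := wordRKHS sum_power_generators.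

(** A power is a single rescaled letter, so the norm bound grows only linearly in [m]. *)
Let power k m : exists2 f : H, (forall x, evalf H f x = b k x ^+ m.+1) &
  `|f| <= (wt (choice.pickle k) * wt m * wt 1)^-1.
Proof.
have [f fE fn] := word_monomial sum_power_generators [:: (k, m)].
have c0 : 0 < wt (choice.pickle k) * wt m by rewrite mulr_gt0// wt_gt0.
exists ((wt (choice.pickle k) * wt m)^-1 *: f) => [x|].
  by rewrite evalfZ fE big_seq1 /gen /= mulKf// gt_eqF.
rewrite normrZ ger0_norm ?invr_ge0 ?(ltW c0)//.
by rewrite [leRHS]invfM ler_wpM2l// invr_ge0 ltW.
Qed.

Let char_power chi k (f : H) m (h : H) : spectrum H chi ->
  (forall x, evalf H f x = b k x) -> (forall x, evalf H h x = b k x ^+ m.+1) ->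
  chi h = chi f ^+ m.+1.
Proof.
move=> chiH fE; elim: m h => [|m ih] h hE.
  rewrite expr1; congr chi; apply: (@evalf_inj _ _ H); apply/funext => x.
  by rewrite hE fE expr1.
have [p pE _] := power k m; rewrite exprS -(ih p pE); apply: (char_mul chiH) => x.
by rewrite hE fE pE exprS.
Qed.

Let char_le1 chi k (f : H) : spectrum H chi ->
  (forall x, evalf H f x = b k x) -> `|chi f| <= 1.
Proof.
move=> chiH fE; have [M M0 chiM] := word_char_bound sum_power_generators.
have nE : `|chi f| = ofR (reC `|chi f|) by rewrite ofR_reC.
(* 3 is the inverse of [wt 1], the weight of a one-letter word. *)
pose K := M * ((wt (choice.pickle k))^-1 * 3%:R).
have K0 : 0 <= K by rewrite !mulr_ge0// invr_ge0 ltW// wt_gt0.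
rewrite nE (_ : 1 = ofR 1)// ofR_le.
apply: (@polynomially_bounded_powers _ _ (reC K)); first exact: reC_ge0.
move=> m; have [p pE pn] := power k m.
have mE : (m.+2%:R : C) = ofR m.+2%:R by rewrite /ofR rmorph_nat.
have tE : ofR (reC `|chi f| ^+ m.+1) = `|chi f| ^+ m.+1.
  by rewrite [in RHS]nE /ofR rmorphXn.
rewrite -ofR_le ofRM tE -mE ofR_reC ?ger0_real// -normrX -(char_power chiH fE pE).
apply: le_trans (chiM _ chiH p) _; rewrite /K -mulrA ler_wpM2l//.
apply: le_trans pn _; rewrite !invfM /wt !invrK -!mulrA ler_wpM2l//.
by rewrite mulrC.
Qed.

(** The interface to the geometry of K: the bound on the generators confines the characters, and the
    last clause identifies a character with an evaluation once the two agree on the [b k]. *)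
Theorem rkha_of_bounded_family : (forall k, continuous (b k)) ->
  exists H : rkhs R X,
    [/\ is_rkha H,
        (forall f : H, continuous (evalf H f : X -> C)),
        (exists e : H, forall x, evalf H e x = 1) &
        [/\ (forall k, exists f : H, forall x, evalf H f x = b k x),
            (forall f h : H, exists p : H, forall x,
               evalf H p x = evalf H f x * evalf H h x),
            (forall chi, spectrum H chi -> forall k (f : H),
               (forall x, evalf H f x = b k x) -> `|chi f| <= 1) &
            (forall chi x, spectrum H chi ->
               (forall k (f : H), (forall y, evalf H f y = b k y) -> chi f = b k x) ->
               forall f : H, chi f = evalf H f x)]].
Proof.
move=> bc; exists H; split.
- exact: wordRKHS_rkha.
- apply: word_eval_continuous => -[k m] x.
  apply: cvgM; first exact: cvg_cst.
  have h n : b k y ^+ n @[y --> x] --> b k x ^+ n.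
    elim: n => [|n ih]; first exact: cvg_cst.
    rewrite exprS; apply: cvg_ext (cvgM (bc k x) ih) => y.
    by rewrite exprS.
  exact: h.
- have [e eE _] := word_monomial sum_power_generators [::]; exists e => x.
  by rewrite eE big_nil.
split.
- by move=> k; have [f fE _] := power k 0; exists f => x; rewrite fE expr1.
- move=> f h.
  have [M _ mulM] := rkha_mul (@word_reproducing _ _ _ _ sum_power_generators)
    (wordRKHS_rkha _).
  by have [p pE _] := mulM f h; exists p.
- by move=> chi chiH k f; exact: char_le1.
move=> chi x chiH chib; apply: word_char_eval => // -[k m] f fE.
have [p pE _] := power k m; have [f0 f0E _] := power k 0.
have fp : f = (wt (choice.pickle k) * wt m) *: p.
  apply: (@evalf_inj _ _ H); apply/funext => y.
  by rewrite evalfZ fE pE.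
have f0b y : evalf H f0 y = b k y by rewrite f0E expr1.
rewrite fp charZ// (char_power chiH f0b pE).
by rewrite (chib k).
Qed.

End PowerGenerators.

(** * Compact subsets of R^n *)

Section CompactSubsets.
Variables (R : realType) (n : nat) (K : set 'rV[R]_n).
Implicit Types (x : 'rV[R]_n) (gam : 'I_n -> R).

(** [c] will be a bound for the coordinates on K, so that [x / c] has coordinates in [-1, 1]. *)
Definition sqdist (c : R) gam x : R := \sum_i (x 0 i / c - gam i) ^+ 2.

Lemma sqdist_ge0 c gam x : 0 <= sqdist c gam x.
Proof. by apply: sumr_ge0 => i _; exact: sqr_ge0. Qed.

Lemma sqdist_continuous c gam : continuous (sqdist c gam).
Proof.
move=> x; have FF : Filter (nbhs x) by exact: nbhs_filter.
apply: (@cvg_big _ _ _ _ _ _ _ (nbhs x)) => [|i _]; first exact: add_continuous.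
have h : y 0 i / c - gam i @[y --> x] --> x 0 i / c - gam i.
  apply: (@cvgB _ _ _ (nbhs x)); last exact: cvg_cst.
  by apply: (@cvgM _ _ (nbhs x)); [exact: coord_continuous|exact: cvg_cst].
exact: (@cvgM _ _ (nbhs x)).
Qed.

Lemma compact_coord_bounded : compact K ->
  exists2 B : R, 0 < B & forall x, K x -> forall i, `|x 0 i| <= B.
Proof.
move=> cK; have [K0|K0] := pselect (K !=set0); last first.
  by exists 1 => // x Kx; case: K0; exists x.
have [|c _ cmax] := @compact_EVT_max _ R (sqdist 1 (fun=> 0)) K K0 cK.
  by apply: continuous_subspaceT; exact: sqdist_continuous.
exists (1 + sqdist 1 (fun=> 0) c).
  by rewrite ltr_pwDl// sqdist_ge0.
move=> x Kx i; have /cmax xc := mem_set Kx.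
have xi : x 0 i ^+ 2 <= sqdist 1 (fun=> 0) x.
  rewrite /sqdist (bigD1 i)//= divr1 subr0 lerDl.
  by apply: sumr_ge0 => j _; exact: sqr_ge0.
have := sqr_ge0 (`|x 0 i| - 1); have := real_normK (num_real (x 0 i)).
rewrite sqrrB; move: xi xc (normr_ge0 (x 0 i)); lra.
Qed.

Lemma compact_limit_point c gam : compact K -> K !=set0 ->
  (forall e, 0 < e -> exists2 x, K x & sqdist c gam x <= e) ->
  exists2 x, K x & forall i, x 0 i / c = gam i.
Proof.
move=> cK K0 Kgam.
have [|x Kx xmin] := @compact_EVT_min _ R (sqdist c gam) K K0 cK.
  by apply: continuous_subspaceT; exact: sqdist_continuous.
exists x; first exact: set_mem.
have : sqdist c gam x <= 0.
  apply/ler_addgt0Pr => e /Kgam[y Ky ye]; rewrite add0r.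
  by apply: le_trans ye; apply: xmin; exact: mem_set.
move=> x0 i; apply/eqP; rewrite -subr_eq0 -sqrf_eq0 eq_le sqr_ge0 andbT.
apply: le_trans x0; rewrite /sqdist (bigD1 i)//= lerDl.
by apply: sumr_ge0 => j _; exact: sqr_ge0.
Qed.

Lemma rational_approx gam (e : R) : 0 < e ->
  exists r : {ffun 'I_n -> rat}, \sum_i (gam i - ratr (r i)) ^+ 2 <= e.
Proof.
(* [t <= 1] gives [t ^+ 2 <= t], so the [n] squared errors sum to at most [n * t <= e]. *)
move=> e0; pose t := Num.min 1 (e / n.+1%:R).
have t0 : 0 < t by rewrite lt_min ltr01 divr_gt0// ltr0n.
have ex i : exists q : rat, ratr q \in `]gam i, gam i + t[.
  by apply: rat_in_itvoo; rewrite ltrDl.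
have [r rP] := choice ex; exists [ffun i => r i].
apply: (@le_trans _ _ (\sum_(i < n) t)).
  apply: ler_sum => i _; rewrite ffunE.
  have := rP i; rewrite in_itv /= => /andP[r1 r2].
  have t1 : t <= 1 by rewrite ge_min lexx.
  have -> : (gam i - ratr (r i)) ^+ 2 = (ratr (r i) - gam i) ^+ 2 by ring.
  apply: (@le_trans _ _ (t ^+ 2)).
    by rewrite lerXn2r ?nnegrE ?subr_ge0 ?(ltW r1) ?(ltW t0)// lerBlDl ltW.
  by rewrite expr2 -[leRHS]mulr1 ler_wpM2l// ltW.
rewrite sumr_const card_ord -[_ *+ _]mulr_natr.
apply: (@le_trans _ _ (e / n.+1%:R * n.+1%:R)); last by rewrite divfK// pnatr_eq0.
by rewrite ler_pM ?ler0n ?(ltW t0)// ?ge_min ?lexx ?orbT// ler_nat.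
Qed.

End CompactSubsets.

(** * Locating the characters in K by peak functions *)

Section Realization.
Variables (R : realType) (n : nat) (K : set 'rV[R]_n).
Local Notation C := (Cplx R).
Variables (B : R) (B0 : 0 < B) (KB : forall x, K x -> forall i, `|x 0 i| <= B).

Let X : topologicalType := set_type K.

Let pt (x : X) : 'rV[R]_n := set_val x.

Let ptK (x : X) : K (pt x).
Proof. exact: set_valP. Qed.

Let ratpt (r : {ffun 'I_n -> rat}) (i : 'I_n) : R := ratr (r i).

(* [0] when K is empty. *)
Definition mindist (r : {ffun 'I_n -> rat}) : R :=
  inf [set sqdist B (ratpt r) x | x in K].

(* Small enough for [peak] to take values in [[0, 1]] on K. *)
Definition damping (r : {ffun 'I_n -> rat}) : R :=
  (1 + \sum_i (1 + `|ratpt r i|) ^+ 2)^-1.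

Let damping_gt0 r : 0 < damping r.
Proof.
by rewrite invr_gt0 ltr_pwDl// sumr_ge0// => i _; rewrite sqr_ge0.
Qed.

Let mindist_lb r : has_lbound [set sqdist B (ratpt r) x | x in K].
Proof. by exists 0 => _ [x _ <-]; exact: sqdist_ge0. Qed.

Let mindist_le r x : K x -> mindist r <= sqdist B (ratpt r) x.
Proof. by move=> Kx; apply: ge_inf => //; exists x. Qed.

Let mindist_ge0 r : 0 <= mindist r.
Proof.
have [K0|K0] := pselect (K !=set0).
  apply: lb_le_inf; first exact: image_nonempty.
  by move=> _ [x _ <-]; exact: sqdist_ge0.
rewrite /mindist (_ : [set _ | _ in _] = set0) ?inf0//; apply/seteqP; split=> //.
by move=> y [x Kx _]; apply: K0; exists x.
Qed.

(** Exceeds 1 exactly where the squared distance to [r] drops below [mindist r]: the bound by 1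
    holds on K and detects points off K. *)
Definition peak r (x : 'rV[R]_n) : R :=
  1 - damping r * (sqdist B (ratpt r) x - mindist r).

Let coord_le1 x i : K x -> `|x 0 i / B| <= 1.
Proof.
move=> Kx; rewrite normrM (gtr0_norm (_ : 0 < B^-1)) ?invr_gt0//.
by rewrite ler_pdivrMr// mul1r; exact: KB.
Qed.

Let peak_le1 r x : K x -> `|peak r x| <= 1.
Proof.
move=> Kx; have d0 := damping_gt0 r; have m0 := mindist_ge0 r.
have h0 : 0 <= damping r * (sqdist B (ratpt r) x - mindist r).
  by rewrite mulr_ge0 ?(ltW d0)// subr_ge0 mindist_le.
have h1 : damping r * (sqdist B (ratpt r) x - mindist r) <= 1.
  rewrite /damping mulrC ler_pdivrMr ?ltr_pwDl//; last first.
    by rewrite sumr_ge0// => i _; rewrite sqr_ge0.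
  rewrite mul1r lerBlDr; apply: (@le_trans _ _ (\sum_i (1 + `|ratpt r i|) ^+ 2)).
    apply: ler_sum => i _; rewrite -[leLHS]real_normK ?num_real//.
    rewrite lerXn2r ?nnegrE ?addr_ge0//; apply: le_trans (ler_normB _ _) _.
    by rewrite lerD2r; exact: coord_le1.
  by rewrite -addrA addrCA lerDl addr_ge0.
by rewrite /peak ler_norml; lra.
Qed.

Definition generators (k : 'I_n + {ffun 'I_n -> rat}) (x : X) : C :=
  match k with
  | inl i => ofR (pt x 0 i / B)
  | inr r => ofR (peak r (pt x))
  end.

Lemma generators_le1 k x : `|generators k x| <= 1.
Proof.
have e : (1 : C) = ofR 1 by [].
case: k => [i|r] /=; rewrite ofR_norm e ofR_le.
  exact: coord_le1 (ptK x).
exact: peak_le1 (ptK x).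
Qed.

Lemma generators_continuous k : continuous (generators k).
Proof.
have ptc : continuous pt by exact: initial_continuous.
have coordc i : continuous (fun x : X => pt x 0 i).
  move=> x; exact: (@continuous_comp _ _ _ pt (fun M : 'rV[R]_n => M 0 i) x
    (ptc x) (@coord_continuous R 1 n 0 i (pt x))).
move=> x; have FF : Filter (nbhs x) by exact: nbhs_filter.
case: k => [i|r] /=; apply: (@cvg_ofR _ _ (nbhs x)).
  by apply: (@cvgM _ _ (nbhs x)); [exact: coordc|exact: cvg_cst].
apply: (@cvgB _ _ _ (nbhs x)); first exact: cvg_cst.
apply: (@cvgM _ _ (nbhs x)); first exact: cvg_cst.
apply: (@cvgB _ _ _ (nbhs x)); last exact: cvg_cst.
exact: (@continuous_comp _ _ _ pt (sqdist B (ratpt r)) x (ptc x)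
  (@sqdist_continuous _ _ _ _ (pt x))).
Qed.

Variable H : rkhs R X.
Hypothesis unit_ex : exists e : H, forall x, evalf H e x = 1.
Hypothesis gens_ex : forall k, exists f : H, forall x, evalf H f x = generators k x.
Hypothesis mul_ex : forall f h : H, exists p : H, forall x,
  evalf H p x = evalf H f x * evalf H h x.
Hypothesis char_le1 : forall chi, spectrum H chi -> forall k (f : H),
  (forall x, evalf H f x = generators k x) -> `|chi f| <= 1.
Hypothesis char_eval : forall chi x, spectrum H chi ->
  (forall k (f : H), (forall y, evalf H f y = generators k y) ->
     chi f = generators k x) ->
  forall f : H, chi f = evalf H f x.

(** A peak is a polynomial in the coordinates and the unit, so [chi] maps it to the same polynomial
    in the numbers [chi (f i)], which at this stage may be complex and off K. *)
Lemma char_peak chi (f : 'I_n -> H) (h : H) r : spectrum H chi ->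
  (forall i x, evalf H (f i) x = generators (inl i) x) ->
  (forall x, evalf H h x = generators (inr r) x) ->
  chi h = 1 - ofR (damping r) *
    (\sum_i (chi (f i) - ofR (ratpt r i)) ^+ 2 - ofR (mindist r)).
Proof.
move=> chiH fE hE; have [e eE] := unit_ex.
have [p pE] := choice (fun i => mul_ex (f i) (f i)).
pose q i := p i - (ofR (ratpt r i) *+ 2) *: f i + (ofR (ratpt r i) ^+ 2) *: e.
have -> : h = e - ofR (damping r) *: (\sum_i q i - ofR (mindist r) *: e).
  apply: (@evalf_inj _ _ H); apply/funext => x.
  rewrite hE evalfB evalfZ evalfB evalfZ evalf_sum eE mulr1 /= /peak.
  rewrite ofRB ofRM ofRB /sqdist ofR_sum; congr (_ - _ * (_ - _)).
  apply: eq_bigr => i _; rewrite evalfD evalfB !evalfZ eE mulr1 pE !fE /=.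
  by rewrite expr2 ofRM ofRB; ring.
rewrite charB// charZ// charB// charZ// char_sum// (char_unit chiH eE) mulr1.
congr (_ - _ * (_ - _)); apply: eq_bigr => i _.
rewrite /q charD// charB// !charZ// (char_unit chiH eE) mulr1.
by rewrite (char_mul chiH (pE i)); ring.
Qed.

Lemma char_point chi : compact K -> spectrum H chi ->
  exists x : X, forall f : H, chi f = evalf H f x.
Proof.
move=> cK chiH.
(* Over the empty set there is a single function, so injectivity of [evalf] makes [H] zero, and no
   nonzero functional is left. *)
have K0 : K !=set0.
  have [_ [f f0] _] := chiH; apply: contrapT => K0; move/negP: f0; apply.
  rewrite (_ : f = 0) ?(char0 chiH)//.
  by apply: (@evalf_inj _ _ H); apply/funext => x; case: K0; exists (pt x).
have [f fE] := choice gens_ex.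
have inlE i x : evalf H (f (inl i)) x = generators (inl i) x by exact: fE.
pose gam i := reC (chi (f (inl i))); pose eta i := imC (chi (f (inl i))).
have main r : mindist r + \sum_i eta i ^+ 2 <= \sum_i (gam i - ratpt r i) ^+ 2.
  have := char_le1 chiH (fE (inr r)).
  rewrite (char_peak chiH inlE (fE (inr r))) => /(le_trans (norm_reC _)).
  rewrite (_ : 1 = ofR 1)// ofR_le => /(le_trans (ler_norm _)).
  rewrite reCB reC_ofRM reCB !reC_ofR reC_sum lerBlDr lerDl.
  rewrite pmulr_rge0 ?damping_gt0// subr_ge0.
  under eq_bigr do rewrite reC_sqrB.
  by rewrite big_split /= sumrN lerBrDr.
have eta0 i : eta i = 0.
  apply/eqP; rewrite -sqrf_eq0 eq_le sqr_ge0 andbT.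
  apply/ler_addgt0Pr => e /(rational_approx gam)[r re]; rewrite add0r.
  apply: le_trans re; apply: le_trans (main r); rewrite (bigD1 i)//=.
  by rewrite addrCA lerDl addr_ge0// sumr_ge0// => j _; rewrite sqr_ge0.
have [|x Kx xgam] := @compact_limit_point _ _ K B gam cK K0.
  (* [mindist r <= e / 8], and [x] nearly attains [mindist r], so its squared distance to [r] is
     below [e / 4]; doubling the sum with the [e / 8] of [re] gives at most [3 e / 4]. *)
  move=> e e0; have e8 : 0 < e / 8 by rewrite divr_gt0.
  have [r re] := rational_approx gam e8.
  have hinf : has_inf [set sqdist B (ratpt r) x | x in K].
    by split; [exact: image_nonempty|exact: mindist_lb].
  have [_ [x Kx <-]] := inf_adherent e8 hinf; rewrite -/(mindist r) => xr.
  exists x => //.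
  have mr : mindist r <= e / 8.
    apply: le_trans re; apply: le_trans (main r); rewrite lerDl.
    by rewrite sumr_ge0// => j _; rewrite sqr_ge0.
  apply: (@le_trans _ _ (2 * (sqdist B (ratpt r) x + \sum_i (gam i - ratpt r i) ^+ 2))).
    rewrite -big_split mulr_sumr; apply: ler_sum => i _ /=.
    (* The identity [2 u^2 + 2 v^2 - (u - v)^2 = (u + v)^2] for the two differences with
       [ratpt r i]. *)
    have := sqr_ge0 ((x 0 i / B - ratpt r i) + (gam i - ratpt r i)).
    by move: (x 0 i / B) (ratpt r i) (gam i) => a b c; nra.
  by move: re xr mr e0; rewrite /ratpt; lra.
exists (exist _ x (mem_set Kx)); apply: char_eval => // k h hE.
have {h hE}-> : h = f k.
  by apply: (@evalf_inj _ _ H); apply/funext => y; rewrite hE fE.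
have chif i : chi (f (inl i)) = ofR (x 0 i / B).
  by rewrite xgam [LHS]ofR_imC0//; exact: eta0.
case: k => [i|r] /=; first exact: chif.
rewrite (char_peak chiH inlE (fE (inr r))) /peak ofRB ofRM ofRB /sqdist ofR_sum.
congr (_ - _ * (_ - _)); apply: eq_bigr => i _.
by rewrite chif -ofRB !expr2 ofRM.
Qed.

End Realization.

(** * The homeomorphism between the spectrum and K *)

Lemma rV_continuous (T : topologicalType) (R : realType) (n : nat)
    (f : T -> 'rV[R]_n) :
  (forall i, continuous (fun t => f t 0 i)) -> continuous f.
Proof.
move=> fc t A [P tP PA].
have : \forall s \near t, forall i : 'I_n, P 0 i (f s 0 i).
  by apply: filter_forall => i; apply: (fc i t); exact: tP.
by apply: filterS => s sP; apply: PA => i j; rewrite ord1.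
Qed.

Theorem mainTheorem7 (R : realType) (n : nat) (K : set 'rV[R]_n) :
  (0 < n)%N -> compact K ->
  exists (X : Type) (H : rkhs R X),
    is_rkha H /\ homeomorphic (set_type (spectrum H)) (set_type K).
Proof.
move=> _ cK; have [B B0 KB] := compact_coord_bounded cK.
have [H [Hrkha Hcont Hunit [Hgen Hmul Hle Hev]]] := rkha_of_bounded_family
  (generators_le1 B0 KB) (@generators_continuous R n K B).
exists (set_type K), H; split=> //.
pose ev (x : set_type K) : {ptws H -> Cplx R} := fun f => evalf H f x.
have evP x : spectrum H (ev x).
  split=> [k f h|//|f g h hE]; last exact: hE.
    by rewrite /ev evalfD evalfZ.
  by have [e eE] := Hunit; exists e; rewrite /ev eE oner_eq0.
have [phi phiP] := choice (fun chi : set_type (spectrum H) =>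
  char_point Hunit Hgen Hmul Hle Hev cK (set_valP chi)).
pose psi x : set_type (spectrum H) := exist _ (ev x) (mem_set (evP x)).
(* The coordinate generators separate the points of K, which makes [phi] a left inverse of [psi]. *)
have ev_inj x y : (forall f, evalf H f x = evalf H f y) -> x = y.
  move=> xy; apply: val_inj; apply/rowP => i.
  have [f fE] := Hgen (inl i); have := xy f; rewrite !fE /= => /(congr1 (@reC R)).
  by rewrite !reC_ofR => /(mulIf (lt0r_neq0 (_ : 0 < B^-1))); apply; rewrite invr_gt0.
exists phi, psi; split.
- apply: continuous_comp_initial; apply: rV_continuous => i.
  have [f fE] := Hgen (inl i).
  (* The [i]-th coordinate of [phi chi] is [B] times the real part of [chi f], and evaluation at [f]
     is continuous for pointwise convergence. *)
  have -> : (fun chi => (set_val \o phi) chi 0 i) =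
      (fun chi : set_type (spectrum H) => reC (set_val chi f) * B).
    apply/funext => chi.
    have -> : set_val chi f = ofR (set_val (phi chi) 0 i / B).
      by have := phiP chi f; rewrite fE; apply.
    by rewrite reC_ofR divfK// gt_eqF.
  move=> chi; have FF : Filter (nbhs chi) by exact: nbhs_filter.
  apply: (@cvgM _ _ (nbhs chi)); last exact: cvg_cst.
  apply: (@cvg_reC _ _ (nbhs chi)).
  apply: (@continuous_comp _ _ _ (set_val : set_type (spectrum H) -> {ptws H -> Cplx R})
    (fun u : {ptws H -> Cplx R} => u f)).
    exact: initial_continuous.
  exact: (@proj_continuous H (fun=> Cplx R) f).
(* Continuity of [psi] for pointwise convergence is the continuity of each function of [H] on K. *)
- apply: continuous_comp_initial => x.
  have FF : Filter (nbhs x) by exact: nbhs_filter.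
  apply: (pointwise_cvgP (F := ev @ nbhs x) (ev x) _).2 => f.
  exact: Hcont.
- move=> chi; apply: val_inj; apply/funext => f.
  by rewrite /= /ev -phiP.
- by move=> x; apply: ev_inj => f; rewrite -phiP.
Qed.
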